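(* Let $D$ be an integral domain and let $\Theta$ be a weak Jaffard family of $D$ pointed at $T_\infty$. Then there is an exact sequence $$0\longrightarrow\bigoplus_{T\in\Theta\setminus\{T_\infty\}}\mathrm{Pic}_{\mathrm{Int}}(T)\longrightarrow\mathrm{Pic}_{\mathrm{Int}}(D)\longrightarrow\mathrm{Pic}_{\mathrm{Int}}(D,T_\infty)\longrightarrow 0.$$
   Context: $D$ is an integral domain with quotient field $K$; for a domain $A$ with quotient field $K$, $\mathrm{Int}(A)=\{f\in K[X]\mid f(A)\subseteq A\}$ and $\mathrm{Pic}(A)$ is the group of invertible fractional ideals modulo principal ones. $\mathrm{Pic}_{\mathrm{Int}}(A):=\mathrm{Pic}(\mathrm{Int}(A))/\iota_A(\mathrm{Pic}(A))$ where $\iota_A([I])=[I\,\mathrm{Int}(A)]$. For a flat overring $T$ of $D$, $\mathrm{Int}(D)T$ is the subring of $K[X]$ of finite sums $\sum f_it_i$ ($f_i\in\mathrm{Int}(D)$, $t_i\in T$), and $\mathrm{Pic}_{\mathrm{Int}}(D,T):=\mathrm{Pic}(\mathrm{Int}(D)T)/\iota_{D,T}(\mathrm{Pic}(T))$ with $\iota_{D,T}([I])=[I\,\mathrm{Int}(D)T]$. An overring is a ring between $D$ and $K$, flat if flat as a $D$-module. A family $\Theta$ of overrings of a domain $R$ (with quotient field $K$) is a pre-Jaffard family of $R$ if: $\Theta=\{K\}$ or $K\notin\Theta$; every member is flat over $R$; $\Theta$ is complete (every ideal $I$ of $R$ equals $\bigcap_{T\in\Theta}IT$); independent ($TT'=K$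 for distinct $T,T'\in\Theta$); and compact in the Zariski topology on overrings (subbasic opens $\{T\mid x_1,\dots,x_n\in T\}$). A Jaffard family is a pre-Jaffard family that is locally finite (each nonzero $x\in R$ is a nonunit in only finitely many members); a Jaffard overring of $R$ is a member of some Jaffard family of $R$. For a pre-Jaffard family $\Theta$ of $D$, let $T_0:=\bigcap\Theta=D$ and let $\mathcal{N}^1(\Theta)$ be the set of $T\in\Theta$ that are not Jaffard overrings of $D$. $\Theta$ is a weak Jaffard family pointed at $T_\infty$ if $\mathcal{N}^1(\Theta)=\{T_\infty\}$. *)

(* Defs.v *)
From HB Require Import structures.
From mathcomp Require Import all_boot all_algebra.
From mathcomp Require Import fraction.
From Stdlib Require List.
Set Implicit Arguments. Unset Strict Implicit. Unset Printing Implicit Defensive.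
Import GRing.Theory.
Local Open Scope ring_scope.

Section Generic.
Variable R : comNzRingType.

Definition subring (S : R -> Prop) : Prop :=
  [/\ S 0, S 1, (forall x y, S x -> S y -> S (x - y))
    & (forall x y, S x -> S y -> S (x * y))].

Definition submod (S I : R -> Prop) : Prop :=
  [/\ I 0, (forall x y, I x -> I y -> I (x + y))
    & (forall a x, S a -> I x -> I (a * x))].

Definition ideal_of (S I : R -> Prop) : Prop :=
  submod S I /\ (forall x, I x -> S x).

Definition prodI (I J : R -> Prop) : R -> Prop :=
  fun z => exists s : seq (R * R),
    (forall p, p \in s -> I p.1 /\ J p.2) /\ z = \sum_(p <- s) p.1 * p.2.

Definition eqI (I J : R -> Prop) : Prop := forall z, I z <-> J z.

End Generic.

(* Fractional and invertible ideals of a subring S of a field F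
   (S having quotient field F)                                          *)
Section FieldIdeals.
Variable F : fieldType.

Definition fractional (S I : F -> Prop) : Prop :=
  [/\ submod S I, (exists x, I x /\ x != 0)
    & exists d, [/\ S d, d != 0 & forall x, I x -> S (d * x)]].

Definition invertible (S I : F -> Prop) : Prop :=
  fractional S I /\ exists J, fractional S J /\ eqI (prodI I J) S.

Definition smul (x : F) (I : F -> Prop) : F -> Prop :=
  fun z => exists y, I y /\ z = x * y.

End FieldIdeals.

(* "Setoid" presentation of abelian groups: a carrier, a membership
   predicate (representatives), the equivalence defining equality of
   classes, the (representative-level) group law and the unit.        *)
Record SGroup := SGroupPack {
  sg_car : Type;
  sg_mem : sg_car -> Prop;
  sg_eqv : sg_car -> sg_car -> Prop;
  sg_op  : sg_car -> sg_car -> sg_car;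
  sg_one : sg_car }.

Definition sg_hom (G H : SGroup) (f : sg_car G -> sg_car H) : Prop :=
  [/\ (forall x, sg_mem x -> sg_mem (f x)),
      (forall x y, sg_mem x -> sg_mem y -> sg_eqv x y -> sg_eqv (f x) (f y))
    & (forall x y, sg_mem x -> sg_mem y ->
          sg_eqv (f (sg_op x y)) (sg_op (f x) (f y)))].

Definition short_exact (A B C : SGroup) : Prop :=
  exists (f : sg_car A -> sg_car B) (g : sg_car B -> sg_car C),
    [/\ sg_hom f, sg_hom g,
        (forall x, sg_mem x -> sg_eqv (f x) (sg_one B) -> sg_eqv x (sg_one A)),
        (forall y, sg_mem y ->
           (sg_eqv (g y) (sg_one C) <-> exists x, sg_mem x /\ sg_eqv (f x) y))
      & (forall z, sg_mem z -> exists y, sg_mem y /\ sg_eqv (g y) z)].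

Definition DSum (I : Type) (P : I -> Prop) (G : I -> SGroup) : SGroup :=
  @SGroupPack (forall i, sg_car (G i))
    (fun s => (forall i, P i -> sg_mem (s i)) /\
              exists l : list I, forall i, P i ->
                 ~ sg_eqv (s i) (sg_one (G i)) -> List.In i l)
    (fun s t => forall i, P i -> sg_eqv (s i) (t i))
    (fun s t i => sg_op (s i) (t i))
    (fun i => sg_one (G i)).

Section Overrings.
Variable K : fieldType.

Definition fullK : K -> Prop := fun _ => True.

Definition quotient_field_of (D : K -> Prop) : Prop :=
  subring D /\ forall x, exists a b, [/\ D a, D b, b != 0 & x = a / b].

Definition is_overring (D T : K -> Prop) : Prop :=
  subring T /\ forall x, D x -> T x.

(* flatness of the D-module T (subset of K), via the equational
   criterion for flatness *)
Definition flat_over (D T : K -> Prop) : Prop :=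
  forall (n : nat) (r m : 'I_n -> K),
    (forall i, D (r i)) -> (forall i, T (m i)) ->
    \sum_(i < n) r i * m i = 0 ->
    exists (k : nat) (y : 'I_k -> K) (a : 'I_n -> 'I_k -> K),
      [/\ (forall j, T (y j)), (forall i j, D (a i j)),
          (forall i, m i = \sum_(j < k) a i j * y j)
        & (forall j, \sum_(i < n) r i * a i j = 0)].

Definition zariski_open (D : K -> Prop) (U : (K -> Prop) -> Prop) : Prop :=
  (forall T, U T -> is_overring D T) /\
  forall T, U T -> exists s : seq K, (forall x, x \in s -> T x) /\
     forall T', is_overring D T' -> (forall x, x \in s -> T' x) -> U T'.

Definition zariski_compact (D : K -> Prop) (Th : (K -> Prop) -> Prop) : Prop :=
  forall (I : Type) (U : I -> (K -> Prop) -> Prop),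
    (forall i, zariski_open D (U i)) ->
    (forall T, Th T -> exists i, U i T) ->
    exists l : list I, forall T, Th T -> exists i, List.In i l /\ U i T.

Definition pre_Jaffard (R : K -> Prop) (Th : (K -> Prop) -> Prop) : Prop :=
  (forall T, Th T -> is_overring R T) /\
  [/\ ((forall T, Th T <-> T = fullK) \/ ~ Th fullK),
      (forall T, Th T -> flat_over R T),
      (forall I, ideal_of R I -> forall x, I x <-> forall T, Th T -> prodI I T x),
      (forall T T', Th T -> Th T' -> T <> T' -> eqI (prodI T T') fullK)
    & (* compact *) zariski_compact R Th].

Definition locally_finite (R : K -> Prop) (Th : (K -> Prop) -> Prop) : Prop :=
  forall x, R x -> x != 0 ->
    exists l : list (K -> Prop), forall T, Th T -> ~ T x^-1 -> List.In T l.

Definition Jaffard_family (R : K -> Prop) (Th : (K -> Prop) -> Prop) : Prop :=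
  pre_Jaffard R Th /\ locally_finite R Th.

Definition Jaffard_overring (R T : K -> Prop) : Prop :=
  exists Th, Jaffard_family R Th /\ Th T.

Definition weak_Jaffard_pointed (D : K -> Prop) (Th : (K -> Prop) -> Prop)
    (Tinf : K -> Prop) : Prop :=
  pre_Jaffard D Th /\
  forall T, (Th T /\ ~ Jaffard_overring D T) <-> T = Tinf.

(* Integer-valued polynomials and the Int-Picard groups.  Fractional
   ideals of subrings of K[X] live in the field K(X) = {fraction {poly K}}. *)
Definition Int (A : K -> Prop) : {poly K} -> Prop :=
  fun f => forall a, A a -> A f.[a].

Definition IntT (D T : K -> Prop) : {poly K} -> Prop :=
  prodI (Int D) (fun p => exists t, T t /\ p = t%:P).

Definition KX := {fraction {poly K}}.

Definition imgX (S : {poly K} -> Prop) : KX -> Prop :=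
  fun y => exists p, S p /\ y = @FracField.tofrac _ p.

Definition constX (I : K -> Prop) : KX -> Prop :=
  imgX (fun p => exists c, I c /\ p = c%:P).

(* Pic(R)/iota(Pic(A)) for a subring A of K and a subring R of K[X]
   containing A: representatives are invertible fractional ideals of R;
   I ~ J iff I = x * J * (I0 R) with x in K(X)^* and I0 an invertible
   fractional ideal of A. *)
Definition PicRel (A : K -> Prop) (R : {poly K} -> Prop) : SGroup :=
  @SGroupPack (KX -> Prop)
    (invertible (imgX R))
    (fun I J => exists x : KX, x != 0 /\ exists I0,
        invertible A I0 /\
        eqI I (smul x (prodI J (prodI (constX I0) (imgX R)))))
    (@prodI _)
    (imgX R).

Definition PicInt (A : K -> Prop) : SGroup := PicRel A (Int A).

Definition PicIntRel (D T : K -> Prop) : SGroup := PicRel T (IntT D T).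

End Overrings.

(* Main.v *)
(** A Jaffard overring [T] has a complement [T'] with [D = T /\ T'] and [T T' = K]; this
    forces [Int(T) = Int(D) T] and lets one replace the localization at [T] of an
    [Int(D)]-submodule of [K(X)], generically equal to [K[X]], by any other one without
    changing its localizations at the other members of the family.  By compactness, an
    element of [T_oo] lies in all but finitely many members, so that finitely many such
    replacements suffice to lift classes, and a class trivial at [T_oo] is trivial at almost
    all members.  A class that is trivial at every member is trivial: after scaling by an
    element of [K(X)], an ideal locally extended from constants is extended from its
    intersection with [K], by completeness of the family.  The first map of the sequence
    hence sends a finite family of classes to the unique class with these localizations
    that is trivial at [T_oo]. *)

From Stdlib Require Import FunctionalExtensionality PropExtensionality.
From Stdlib Require Import Classical ClassicalEpsilon.
Require Import Defs.
From mathcomp Require Import all_boot all_algebra.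
From mathcomp Require Import fraction.
From mathcomp Require Import ring.

Set Implicit Arguments. Unset Strict Implicit. Unset Printing Implicit Defensive.
Import GRing.Theory.
Local Open Scope ring_scope.

Local Notation "I ** J" := (prodI I J) (at level 40, left associativity).
Local Notation "I [<=] J" := (forall z, I z -> J z) (at level 70).

(** The obstacle is that triviality of a class at [T] modulo constant ideals comes with a scalar of
    K(X) and an ideal of [T] that both depend on [T]. The generic localization reconciles the
    scalars: all rings Int(D) T have the same extension Int(D) K = K[X], a principal ideal domain
    whose units are the nonzero constants, so two scalars that generate the same K[X]-module differ
    by a constant, which the constant ideal absorbs. At T_oo no identity between Int(T_oo) and
    Int(D) T_oo is at hand, so everything is phrased with the rings Int(D) T inside K(X). Flatness
    acts through ideals of denominators, which make localization commute with finite intersections;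
    gluing and intersecting with K rest on this. Invertible modules travel with their inverses, so
    that invertibility can be checked member by member, and sets are identified by extensionality,
    so that identities of modules can be rewritten. *)

Lemma pred_ext (T : Type) (I J : T -> Prop) : I [<=] J -> J [<=] I -> I = J.
Proof.
move=> h1 h2; apply: functional_extensionality => z.
by apply: propositional_extensionality; split; [apply: h1 | apply: h2].
Qed.

Definition capI (T : Type) (I J : T -> Prop) : T -> Prop := fun z => I z /\ J z.

(** * Products of subsets of a ring *)

Section ProductsOfSets.
Variable R : comNzRingType.
Implicit Types (S I J M N : R -> Prop) (s : seq R).

Definition add_closed M := M 0 /\ forall x y, M x -> M y -> M (x + y).

Definition mem_seq s : R -> Prop := fun x => x \in s.

Lemma submod_add S M : submod S M -> add_closed M.
Proof. by case. Qed.

Lemma prodI_add I J : add_closed (I ** J).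
Proof.
split; first by exists [::]; rewrite big_nil; split.
move=> x y [s [hs ->]] [t [ht ->]]; exists (s ++ t); rewrite big_cat; split=> // p.
by rewrite mem_cat => /orP[/hs|/ht].
Qed.

Lemma prodI_mul I J x y : I x -> J y -> (I ** J) (x * y).
Proof.
move=> hx hy; exists [:: (x, y)]; rewrite big_seq1; split=> // p.
by rewrite inE => /eqP ->.
Qed.

Lemma prodI_min I J M :
  add_closed M -> (forall x y, I x -> J y -> M (x * y)) -> (I ** J) [<=] M.
Proof.
move=> [M0 MD] h z [s [hs ->]]; elim: s hs => [|p s IH] hs; first by rewrite big_nil.
rewrite big_cons; apply: MD.
  by case: (hs p (mem_head _ _)); apply: h.
by apply: IH => q hq; apply: hs; rewrite inE hq orbT.
Qed.

Lemma prodI_mono I I' J J' : I [<=] I' -> J [<=] J' -> I ** J [<=] I' ** J'.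
Proof.
move=> hI hJ; apply: prodI_min; first exact: prodI_add.
by move=> x y /hI hx /hJ hy; apply: prodI_mul.
Qed.

Lemma prodIC I J : I ** J = J ** I.
Proof.
by apply: pred_ext; apply: prodI_min (prodI_add _ _) _ => x y hx hy;
  rewrite mulrC; apply: prodI_mul.
Qed.

Lemma add_closed_mulr M a : add_closed M -> add_closed (fun x => M (x * a)).
Proof.
by move=> [M0 MD]; split=> [|x y hx hy]; rewrite ?mul0r // mulrDl; apply: MD.
Qed.

Lemma add_closed_mull M a : add_closed M -> add_closed (fun x => M (a * x)).
Proof.
by move=> [M0 MD]; split=> [|x y hx hy]; rewrite ?mulr0 // mulrDr; apply: MD.
Qed.

Lemma prodIA I J M : I ** (J ** M) = I ** J ** M.
Proof.
apply: pred_ext; apply: prodI_min; try exact: prodI_add.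
- move=> x y hx; move: y; apply: prodI_min.
    by apply: add_closed_mull; apply: prodI_add.
  by move=> y z hy hz; rewrite mulrA; do 2!apply: prodI_mul => //.
- move=> w z hw hz; move: w hw; apply: prodI_min.
    by apply: add_closed_mulr; apply: prodI_add.
  by move=> x y hx hy; rewrite -mulrA; do 2!apply: prodI_mul => //.
Qed.

Lemma prodIAC I J M : I ** J ** M = I ** M ** J.
Proof. by rewrite -!prodIA (prodIC J). Qed.

Lemma prodIACA I J M N : (I ** J) ** (M ** N) = (I ** M) ** (J ** N).
Proof. by rewrite prodIA (prodIAC I J M) -prodIA. Qed.

Lemma submod_prodl S I J : submod S I -> submod S (I ** J).
Proof.
move=> [I0 ID IM]; have [h0 hD] := prodI_add I J; split=> // a x ha; move: x.
apply: prodI_min; first by apply: add_closed_mull; apply: prodI_add.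
by move=> x y hx hy; rewrite mulrA; apply: prodI_mul => //; apply: IM.
Qed.

Lemma submod_prodr S I J : submod S J -> submod S (I ** J).
Proof. by rewrite prodIC; apply: submod_prodl. Qed.

Lemma submod_sub S S' M : S [<=] S' -> submod S' M -> submod S M.
Proof. by move=> h [h0 hD hM]; split=> // a x /h; apply: hM. Qed.

Lemma submod_cap S M N : submod S M -> submod S N -> submod S (capI M N).
Proof.
move=> [M0 MD MM] [N0 ND NM]; split=> // [x y [h1 h2] [h3 h4]|a x ha [h1 h2]].
  by split; [apply: MD | apply: ND].
by split; [apply: MM | apply: NM].
Qed.

Section Subring.
Variables (S : R -> Prop) (hS : subring S).

Lemma subr0 : S 0. Proof. by case: hS. Qed.
Lemma subr1 : S 1. Proof. by case: hS. Qed.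
Lemma subrM x y : S x -> S y -> S (x * y). Proof. by case: hS => _ _ _; apply. Qed.
Lemma subrB x y : S x -> S y -> S (x - y). Proof. by case: hS => _ _ h _; apply: h. Qed.
Lemma subrN x : S x -> S (- x).
Proof. by move=> hx; rewrite -sub0r; apply: subrB => //; apply: subr0. Qed.
Lemma subrD x y : S x -> S y -> S (x + y).
Proof. by move=> hx hy; rewrite -[y]opprK; apply: subrB => //; apply: subrN. Qed.

Lemma submod_self : submod S S.
Proof. by split; [apply: subr0 | apply: subrD | move=> a x; apply: subrM]. Qed.

Lemma submod_prodI I : submod S I -> I ** S = I.
Proof.
move=> hI; apply: pred_ext; last first.
  by move=> z hz; rewrite -[z]mulr1; apply: prodI_mul => //; apply: subr1.
apply: prodI_min; first exact: submod_add hI.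
by case: hI => _ _ h x y hx hy; rewrite mulrC; apply: h.
Qed.

Lemma prodI_self : S ** S = S.
Proof. exact: submod_prodI submod_self. Qed.

Lemma sub_prodI I : I [<=] I ** S.
Proof. by move=> z hz; rewrite -[z]mulr1; apply: prodI_mul => //; apply: subr1. Qed.

Lemma submod_prodS I : submod S (I ** S).
Proof. exact: submod_prodr submod_self. Qed.

End Subring.

Lemma prodI_overring S T : subring S -> subring T -> S [<=] T -> S ** T = T.
Proof.
move=> hS hT hST; rewrite prodIC; apply: submod_prodI => //.
exact: submod_sub hST (submod_self hT).
Qed.

Lemma subring_prodI S T : subring S -> subring T -> subring (S ** T).
Proof.
move=> hS hT; have [h0 hD] := prodI_add S T; split=> //.
- by rewrite -[1]mulr1; apply: prodI_mul; apply: subr1.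
- move=> x y hx hy; apply: hD => //; rewrite -mulN1r.
  have [_ _ hM] := submod_prodl T (submod_self hS); apply: hM => //.
  by apply: subrN; last apply: subr1.
- move=> x y hx hy; have : (S ** T ** (S ** T)) (x * y) by apply: prodI_mul.
  by rewrite prodIACA !prodI_self.
Qed.

(** The factors of a finite sum equal to 1 generate [I] and [J] when these are mutually inverse
    ([pinv_span]): this is the finite generation of invertible modules. *)
Lemma fg_sub I J :
  (I ** J) 1 -> exists s1 s2, [/\ mem_seq s1 [<=] I, mem_seq s2 [<=] J
                                & (mem_seq s1 ** mem_seq s2) 1].
Proof.
case=> s [hs ->]; exists (map fst s), (map snd s); split.
- by move=> x /mapP [p hp ->]; case: (hs p hp).
- by move=> x /mapP [p hp ->]; case: (hs p hp).
by exists s; split=> // p hp; split; apply: map_f.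
Qed.

End ProductsOfSets.

(** * Localization at flat overrings *)

Definition imI (K L : Type) (c : K -> L) (I : K -> Prop) : L -> Prop :=
  fun y => exists t, I t /\ y = c t.

(** The conductor of [z] into [M], pulled back to [D] along [c]. It turns membership in a submodule
    of [L], or in its localizations, into a statement on ideals of [D]. *)
Definition cond (K L : comNzRingType) (c : K -> L) (D : K -> Prop) (M : L -> Prop) (z : L) :=
  fun d => D d /\ M (c d * z).

(* Consequence of flatness: the denominators in [D] of an element of [T] generate
   the unit ideal of [T]. *)
Definition den (K : comNzRingType) (D T : K -> Prop) :=
  forall t, T t -> (cond idfun D D t ** T) 1.

Lemma imI_id (K : Type) (I : K -> Prop) : imI idfun I = I.
Proof. by apply: pred_ext => z; [case=> t [h ->] | exists z]. Qed.

Section Image.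
Variables (K L : comNzRingType) (c : {rmorphism K -> L}).
Implicit Types (I J D T : K -> Prop) (M N : L -> Prop).

Lemma imI_mono I J : I [<=] J -> imI c I [<=] imI c J.
Proof. by move=> h z [t [ht ->]]; exists t; split=> //; apply: h. Qed.

Lemma imI_mem I x : I x -> imI c I (c x).
Proof. by exists x. Qed.

Lemma imI_add I : add_closed I -> add_closed (imI c I).
Proof.
move=> [h0 hD]; split; first by exists 0; rewrite rmorph0.
by move=> _ _ [x [hx ->]] [y [hy ->]]; exists (x + y); rewrite rmorphD; split=> //; apply: hD.
Qed.

Lemma preim_add M : add_closed M -> add_closed (fun x => M (c x)).
Proof.
by move=> [h0 hD]; split=> [|x y hx hy]; rewrite ?rmorph0 // rmorphD; apply: hD.
Qed.

Lemma imI_prodI I J : imI c (I ** J) = imI c I ** imI c J.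
Proof.
apply: pred_ext; last first.
  apply: prodI_min; first exact: imI_add (prodI_add _ _).
  move=> _ _ [x [hx ->]] [y [hy ->]].
  by exists (x * y); rewrite rmorphM; split=> //; apply: prodI_mul.
move=> _ [x [hx ->]]; move: x hx; apply: prodI_min; first exact: preim_add (prodI_add _ _).
by move=> x y hx hy; rewrite rmorphM; apply: prodI_mul; apply: imI_mem.
Qed.

Lemma imI_subring D : subring D -> subring (imI c D).
Proof.
case=> h0 h1 hB hM; split.
- by exists 0; rewrite rmorph0.
- by exists 1; rewrite rmorph1.
- by move=> _ _ [x [hx ->]] [y [hy ->]]; exists (x - y); rewrite rmorphB; split=> //; apply: hB.
- by move=> _ _ [x [hx ->]] [y [hy ->]]; exists (x * y); rewrite rmorphM; split=> //; apply: hM.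
Qed.

Lemma imI_submod D I : submod D I -> submod (imI c D) (imI c I).
Proof.
move=> hI; have [h0 hD] := imI_add (submod_add hI); split=> // _ _ [a [ha ->]] [x [hx ->]].
by exists (a * x); rewrite rmorphM; split=> //; case: hI => _ _; apply.
Qed.

Lemma preim_submod D M : submod (imI c D) M -> submod D (fun x => M (c x)).
Proof.
move=> hM; have [h0 hD] := preim_add (submod_add hM); split=> // a x ha hx.
by rewrite rmorphM; case: hM => _ _; apply=> //; apply: imI_mem.
Qed.

Lemma imI_preim M : imI c (fun x => M (c x)) = capI M (imI c (fun=> True)).
Proof.
apply: pred_ext; first by move=> _ [t [ht ->]]; split=> //; exists t.
by move=> z [h [t [_ e]]]; exists t; rewrite -e.
Qed.

Lemma imI_eq I J : injective c -> imI c I = imI c J -> I = J.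
Proof.
move=> inj e; apply: pred_ext => z hz.
  have : imI c J (c z) by rewrite -e; apply: imI_mem.
  by case=> t [ht /inj ->].
have : imI c I (c z) by rewrite e; apply: imI_mem.
by case=> t [ht /inj ->].
Qed.

End Image.

Section FlatLocalization.
Variables (K L : comNzRingType) (c : {rmorphism K -> L}) (D T : K -> Prop).
Hypotheses (hD : subring D) (hT : subring T) (hDT : D [<=] T) (dT : den D T).
Implicit Types (M N : L -> Prop).

Lemma cond_submod M z : submod (imI c D) M -> submod D (cond c D M z).
Proof.
move=> [M0 MD MM]; split.
- by split; [apply: subr0 | rewrite rmorph0 mul0r].
- move=> x y [hx mx] [hy my]; split; first exact: subrD.
  by rewrite rmorphD mulrDl; apply: MD.
- move=> a x ha [hx mx]; split; first exact: subrM.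
  by rewrite rmorphM -mulrA; apply: MM => //; apply: imI_mem.
Qed.

(** Two ideals of [D] that generate the unit ideal of [T] have a product that does so too, and the
    conductor of [z'] contains the product of the other two. *)
Lemma cond_combine M N M' z1 z2 z' :
  (forall d1 d2, cond c D M z1 d1 -> cond c D N z2 d2 -> M' (c (d1 * d2) * z')) ->
  submod (imI c D) M' ->
  (cond c D M z1 ** T) 1 -> (cond c D N z2 ** T) 1 -> (cond c D M' z' ** T) 1.
Proof.
move=> h hM' h1 h2; have : (cond c D M z1 ** T ** (cond c D N z2 ** T)) 1.
  by rewrite -[X in _ X]mulr1; apply: prodI_mul.
rewrite prodIACA prodI_self //; apply: prodI_mono => //.
apply: prodI_min; first exact: submod_add (cond_submod z' hM').
by move=> d1 d2 h3 h4; split; [case: h3 => + _; case: h4 => + _; move=> ? ?; apply: subrM | apply: h].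
Qed.

(** The conductor takes the place of a single denominator: if 1 is a sum of d t with d z in [M],
    multiplying by [z] puts [z] in the localization. Conversely [dT] treats a product m t, and for
    sums the conductors are multiplied. *)
Lemma mem_localP M z :
  submod (imI c D) M -> (M ** imI c T) z <-> (cond c D M z ** T) 1.
Proof.
move=> hM; split; last first.
  move=> h; rewrite -[z]mul1r -(rmorph1 c); move: (1 : K) h.
  apply: prodI_min; first by apply: preim_add (add_closed_mulr _ (prodI_add _ _)).
  move=> d t [_ hd] ht; rewrite rmorphM mulrAC; apply: prodI_mul => //; exact: imI_mem.
move: z; apply: prodI_min; first split.
- rewrite -[1]mulr1; apply: prodI_mul; last exact: subr1.
  by split; [apply: subr1 | rewrite mulr0; case: hM].
- move=> x y; apply: cond_combine => // d1 d2 [hd1 h1] [hd2 h2].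
  rewrite mulrDr; case: hM => _ MD MM; apply: MD; rewrite rmorphM.
    by rewrite mulrAC mulrC; apply: MM => //; apply: imI_mem.
  by rewrite -mulrA; apply: MM => //; apply: imI_mem.
- move=> m _ hm [t [ht ->]]; apply: prodI_mono (dT ht) => // d [hd hdt].
  split=> //; case: hM => _ _ MM; rewrite mulrCA -rmorphM mulrC.
  by apply: MM => //; apply: imI_mem.
Qed.

(** The product of the two conductors sends [z] into both modules and still generates the unit ideal
    of [T]. *)
Lemma prodI_cap M N : submod (imI c D) M -> submod (imI c D) N ->
  capI M N ** imI c T = capI (M ** imI c T) (N ** imI c T).
Proof.
move=> hM hN; apply: pred_ext.
  by move=> z hz; split; apply: prodI_mono hz => // w [].
move=> z []; rewrite !mem_localP //; last exact: submod_cap.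
move=> h1 h2; apply: cond_combine h1 h2; last exact: submod_cap.
move=> d1 d2 [hd1 h1] [hd2 h2]; rewrite rmorphM; split; case: hM hN => _ _ MM [_ _ NM].
  by rewrite mulrAC mulrC; apply: MM => //; apply: imI_mem.
by rewrite -mulrA; apply: NM => //; apply: imI_mem.
Qed.

End FlatLocalization.

Definition complete (K : comNzRingType) (D : K -> Prop) (Th : (K -> Prop) -> Prop) :=
  (forall T, Th T -> [/\ subring T, D [<=] T & den D T]) /\
  forall I, ideal_of D I -> (forall T, Th T -> (I ** T) 1) -> I 1.

Section Complete.
Variables (K L : comNzRingType) (c : {rmorphism K -> L}) (D : K -> Prop).
Variables (Th : (K -> Prop) -> Prop) (hD : subring D) (hTh : complete D Th).
Implicit Types (M N : L -> Prop).

(** Completeness concerns ideals of [D]; applied to the conductor of [z], it reaches submodules of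
    any [L]. *)
Lemma complete_mem M z : submod (imI c D) M ->
  (forall T, Th T -> (M ** imI c T) z) -> M z.
Proof.
move=> hM h; case: hTh => hO hC.
have : cond c D M z 1.
  apply: hC; first by split; [apply: cond_submod | move=> x []].
  by move=> T hT; have [sT DT dT] := hO T hT; apply/(mem_localP hD sT dT z hM); apply: h.
by case=> _; rewrite rmorph1 mul1r.
Qed.

Lemma complete_eq M N : submod (imI c D) M -> submod (imI c D) N ->
  (forall T, Th T -> M ** imI c T = N ** imI c T) -> M = N.
Proof.
move=> hM hN h; apply: pred_ext => z hz; apply: complete_mem => // T hT.
  rewrite -h //; apply: sub_prodI => //; apply: imI_subring.
  by case: hTh => hO _; case: (hO T hT).
rewrite h //; apply: sub_prodI => //; apply: imI_subring.
by case: hTh => hO _; case: (hO T hT).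
Qed.

End Complete.

(** * Jaffard overrings and their complements *)

(* A complement [T'] of [T]: locally at [T] and at [T'], the ideal [b T /\ D] of [D]
   becomes [b T] and the unit ideal, so that it is comaximal with [b T' /\ D]. *)
Definition comp_pair (K : fieldType) (D T T' : K -> Prop) :=
  [/\ subring T, subring T', D [<=] T, D [<=] T' &
      (forall x, T x -> T' x -> D x) /\
      forall b, D b -> b != 0 -> exists e, [/\ D e, T (e / b) & T' ((1 - e) / b)]].

(** For t = a/b the equational criterion applies to a 1 - b t = 0. It writes 1 as a sum of A_0j y_j
    with a A_0j = b A_1j, so that A_0j t = A_1j lies in [D] and each A_0j is a denominator of
    [t]. *)
Lemma flat_den (K : fieldType) (D T : K -> Prop) :
  quotient_field_of D -> is_overring D T -> flat_over D T -> den D T.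
Proof.
move=> [hD hq] [hT DT] hf t ht; have [a [b [ha hb b0 et]]] := hq t.
have [] := hf 2 (fun i => if i == 0 then a else - b) (fun i => if i == 0 then 1 else t).
- by move=> i; case: ifP => _ //; apply: subrN.
- by move=> i; case: ifP => _ //; apply: subr1.
- by rewrite !big_ord_recl big_ord0 /= et; field.
move=> k [y [A [hy hA e hr]]]; have e1 := e 0; have e2 := e 1.
rewrite /= in e1 e2; rewrite e1.
have [M0 MD] := prodI_add (cond idfun D D t) T.
apply: big_ind => // j _; apply: prodI_mul => //; split=> //=.
have := hr j; rewrite !big_ord_recl big_ord0 /= addr0 => hj.
suff -> : A 0 j * t = A (lift ord0 ord0) j by apply: hA.
rewrite et; move/eqP: hj; rewrite mulNr subr_eq0 => /eqP hj.
by apply: (mulfI b0); rewrite -hj; field.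
Qed.

Lemma pair_sym (K : fieldType) (D T T' : K -> Prop) : comp_pair D T T' -> comp_pair D T' T.
Proof.
case=> sT sT' DT DT' [hI he]; split=> //; split=> [x h1 h2|b hb b0]; first exact: hI.
have [e [hDe h1 h2]] := he b hb b0; exists (1 - e); split=> //; last by rewrite subKr.
apply: hI; apply: subrB; rewrite ?subr1 //; try exact: subr1; first exact: DT.
exact: DT'.
Qed.

Section Pair.
Variables (K : fieldType) (D T T' : K -> Prop).
Hypotheses (hq : quotient_field_of D) (hP : comp_pair D T T').
Let hD : subring D. Proof. by case: hq. Qed.
Let sT : subring T. Proof. by case: hP. Qed.
Let sT' : subring T'. Proof. by case: hP. Qed.
Let DT : D [<=] T. Proof. by case: hP. Qed.
Let DT' : D [<=] T'. Proof. by case: hP. Qed.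

Lemma pair_full : T ** T' = (fun=> True).
Proof.
apply: pred_ext => // x _; case: hq => _ /(_ x) [a [b [ha hb b0 ->]]].
case: hP => _ _ _ _ [_ /(_ b hb b0)] [e [he h1 h2]].
have [_ MD] := prodI_add T T'.
have -> : a / b = (e / b) * a + a * ((1 - e) / b) by field.
by apply: MD; apply: prodI_mul => //; [apply: DT' | apply: DT].
Qed.

(** With t = a/b, both e and b are denominators of [t]: e t = (e/b) a lies in [T], and in [T'],
    hence in [D]. They generate the unit ideal of [T'] since (1 - e)/b lies there. *)
Lemma pair_den : den D T'.
Proof.
move=> t ht; case: hq => _ /(_ t) [a [b [ha hb b0 et]]].
case: hP => _ _ _ _ [hI /(_ b hb b0)] [e [he h1 h2]].
have [_ MD] := prodI_add (cond idfun D D t) T'.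
have -> : 1 = e * 1 + b * ((1 - e) / b) by field.
apply: MD; apply: prodI_mul => //; try exact: subr1; split=> //=.
  apply: hI; last by apply: subrM => //; apply: DT'.
  by rewrite et mulrA mulrAC; apply: subrM => //; apply: DT.
by rewrite et mulrCA divff // mulr1.
Qed.

(** [b] is a product of denominators of the coefficients from [T]. For a coefficient t = a/b, e t =
    (e/b) a is in [T'], and it is in [T], so in [D]. *)
Lemma pair_clear I x : ideal_of D I -> (I ** T) x ->
  exists b, [/\ D b, b != 0 & forall e, D e -> T' (e / b) -> I (e * x)].
Proof.
move=> [[I0 ID IM] ID']; move: x; apply: prodI_min; first split.
- exists 1; split; rewrite ?oner_eq0 //; first exact: subr1.
  by move=> e _ _; rewrite mulr0.
- move=> x y [b1 [hb1 n1 h1]] [b2 [hb2 n2 h2]]; exists (b1 * b2); split.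
  + exact: subrM.
  + by rewrite mulf_neq0.
  move=> e he hT; rewrite mulrDr; apply: ID; [apply: h1 | apply: h2] => //.
    have -> : e / b1 = e / (b1 * b2) * b2 by field; rewrite n1 n2.
    by apply: subrM => //; apply: DT'.
  have -> : e / b2 = e / (b1 * b2) * b1 by field; rewrite n1 n2.
  by apply: subrM => //; apply: DT'.
- move=> i t hi ht; case: hq => _ /(_ t) [a [b [ha hb b0 et]]].
  exists b; split=> // e he hT; rewrite mulrCA mulrC; apply: IM => //.
  case: hP => _ _ _ _ [hI _]; apply: hI; first by apply: subrM => //; apply: DT.
  by rewrite et mulrA mulrAC; apply: subrM => //; apply: DT'.
Qed.

End Pair.

Section PairFacts.
Variables (K : fieldType) (D T T' : K -> Prop).
Hypotheses (hq : quotient_field_of D) (hP : comp_pair D T T').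
Let hD : subring D. Proof. by case: hq. Qed.
Let sT : subring T. Proof. by case: hP. Qed.
Let sT' : subring T'. Proof. by case: hP. Qed.
Let DT : D [<=] T. Proof. by case: hP. Qed.
Let DT' : D [<=] T'. Proof. by case: hP. Qed.

(** If [b1] and [b2] clear the expressions of 1 at [T] and at [T'], the element [e] attached to
    [b1 * b2] is divisible by [b2] in [T], and [1 - e] by [b1] in [T']; hence both lie in [I]. *)
Lemma pair_complete : complete D (fun S => S = T \/ S = T').
Proof.
split.
  move=> S [] ->; split=> //; first exact: pair_den hq (pair_sym hP).
  exact: pair_den hq hP.
move=> I hI h.
have [b1 [hb1 n1 h1]] := pair_clear hq hP hI (h _ (or_introl erefl)).
have [b2 [hb2 n2 h2]] := pair_clear hq (pair_sym hP) hI (h _ (or_intror erefl)).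
have n12 : b1 * b2 != 0 by rewrite mulf_neq0.
case: hP => _ _ _ _ [_ /(_ (b1 * b2))] [||e [he k1 k2]] //; first exact: subrM.
have -> : 1 = e * 1 + (1 - e) * 1 :> K by ring.
case: hI => [[_ ID _] _]; apply: ID.
  apply: h2 => //; have -> : e / b2 = e / (b1 * b2) * b1 by field; rewrite n1 n2.
  by apply: subrM => //; apply: DT.
apply: h1; first by apply: (subrB hD) => //; apply: subr1.
have -> : (1 - e) / b1 = (1 - e) / (b1 * b2) * b2 by field; rewrite n1 n2.
by apply: subrM => //; apply: DT'.
Qed.

(** Checked locally at the two members of the pair: an element of [T'] lies in S T = K and in S
    T'. *)
Lemma pair_sub_other S : subring S -> D [<=] S -> T ** S = (fun=> True) -> T' [<=] S.
Proof.
move=> sS DS hS z hz.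
apply: (complete_mem (c := idfun) hD pair_complete); rewrite ?imI_id.
  exact: submod_sub DS (submod_self sS).
move=> S' [] ->; rewrite imI_id; first by rewrite prodIC hS.
by rewrite -[z]mul1r; apply: prodI_mul => //; apply: subr1.
Qed.

Lemma pair_approx t b : T t -> D b -> b != 0 -> exists d, D d /\ T ((t - d) / b).
Proof.
move=> ht hb b0; case: hq => _ /(_ t) [a [s [ha hs s0 et]]].
case: hP => _ _ _ _ [hI /(_ (b * s))] [||e [he k1 k2]].
- exact: subrM.
- by rewrite mulf_neq0.
(* [e] is attached to [b * s], with [s] a denominator of [t]: the factor [s] brings (1 - e) t into
   [T'], and the factor [b] makes e t divisible by [b] in [T]. *)
exists ((1 - e) * t); split.
  apply: hI; first by apply: subrM => //; apply: (subrB sT); [apply: subr1 | apply: DT].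
  have -> : (1 - e) * t = (1 - e) / (b * s) * (b * a) by rewrite et; field; rewrite b0 s0.
  by apply: subrM => //; apply: DT'; apply: subrM.
have -> : (t - (1 - e) * t) / b = e / (b * s) * a by rewrite et; field; rewrite b0 s0.
by apply: subrM => //; apply: DT.
Qed.

End PairFacts.

Lemma pre_Jaffard_complete (K : fieldType) (D : K -> Prop) Th :
  quotient_field_of D -> pre_Jaffard D Th -> complete D Th.
Proof.
move=> hq [hO [_ hf hc _ _]]; split.
  move=> T hT; have [sT DT] := hO T hT; split=> //.
  exact: flat_den hq (hO T hT) (hf T hT).
move=> I hI h; by apply/hc.
Qed.

(** [fun d => S (d / b)] is the module b S, and S T = K contains 1/b. *)
Lemma divided_local (K : fieldType) (S T : K -> Prop) b :
  subring S -> b != 0 -> S ** T = (fun=> True) -> ((fun d => S (d / b)) ** T) 1.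
Proof.
move=> sS b0 hST; have : (S ** T) b^-1 by rewrite hST.
suff h : S ** T [<=] (fun y => ((fun d => S (d / b)) ** T) (b * y)).
  by move/h; rewrite divff.
apply: prodI_min; first exact: add_closed_mull (prodI_add _ _).
by move=> x y hx hy; rewrite mulrA; apply: prodI_mul => //; rewrite mulrAC divff ?mul1r.
Qed.

Lemma divided_submod (K : fieldType) (D S : K -> Prop) b :
  subring S -> D [<=] S -> submod D (fun d => S (d / b)).
Proof.
move=> sS DS; split; first by rewrite mul0r; apply: subr0.
  by move=> x y hx hy; rewrite mulrDl; apply: subrD.
by move=> a x ha hx; rewrite -mulrA; apply: subrM => //; apply: DS.
Qed.

(** [T'] is the intersection of the other members. For given [b], the ideals b T /\ D and b T' /\ D
    are comaximal by completeness: the former becomes the unit ideal at each member other than [T]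
    by independence, the latter at [T], because local finiteness makes it a finite intersection. *)
Lemma jaffard_pair (K : fieldType) (D T : K -> Prop) :
  quotient_field_of D -> Jaffard_overring D T -> exists T', comp_pair D T T'.
Proof.
move=> hq [Th [[hpre hlf] hT]]; have hC := pre_Jaffard_complete hq hpre.
have hD : subring D by case: hq.
case: (hpre) => hO [_ _ _ hind _].
have sub S : Th S -> subring S by move=> /hO [].
have over S : Th S -> D [<=] S by move=> /hO [].
have full S S' : Th S -> Th S' -> S <> S' -> S ** S' = (fun=> True).
  by move=> h1 h2 n; apply: pred_ext => // z _; apply/(hind S S' h1 h2 n).
pose T' x := forall S, Th S -> S <> T -> S x.
have sT' : subring T'.
  split=> [S hS _|S hS _|x y hx hy S hS n|x y hx hy S hS n].
  - exact: subr0 (sub S hS).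
  - exact: subr1 (sub S hS).
  - by apply: subrB (sub S hS) _ _ _ _; [apply: hx | apply: hy].
  - by apply: subrM (sub S hS) _ _ _ _; [apply: hx | apply: hy].
have DT' : D [<=] T' by move=> x hx S hS _; apply: over.
exists T'; split=> //; [exact: sub | exact: over | split].
  move=> x hx hx'; apply: (complete_mem (c := idfun) hD hC).
    by rewrite imI_id; apply: submod_self.
  move=> S hS; rewrite imI_id -[x]mul1r; apply: prodI_mul; first exact: subr1.
  by case: (classic (S = T)) => [-> //|n]; apply: hx'.
move=> b hb b0; have [l hl] := hlf b hb b0.
pose I d := D d /\ T (d / b).
pose J (l : list (K -> Prop)) d :=
  D d /\ forall S, List.In S l -> Th S -> S <> T -> S (d / b).
(* Outside [l] the element [b] is a unit of [S], so divisibility by [b] is automatic there. *)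
have JT' d : J l d -> T' (d / b).
  move=> [hd h] S hS n; case: (classic (List.In S l)) => [hi|hi]; first exact: h.
  apply: subrM (sub S hS) _ _ _ _; first exact: over.
  by apply: NNPP => k; apply: hi; apply: hl.
have DDT S : Th S -> (D ** S) 1.
  by move=> hS; rewrite -[1]mulr1; apply: prodI_mul; apply: subr1 => //; apply: sub.
have sI : submod D I.
  by apply: submod_cap (submod_self hD) _; apply: divided_submod; [apply: sub | apply: over].
have sJ l' : submod D (J l').
  apply: submod_cap (submod_self hD) _; split.
  - by move=> S hi hS n; rewrite mul0r; apply: subr0 (sub S hS).
  - move=> x y hx hy S hi hS n; rewrite mulrDl.
    by apply: subrD (sub S hS) _ _ _ _; [apply: hx | apply: hy].
  - move=> a x ha hx S hi hS n; rewrite -mulrA.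
    by apply: subrM (sub S hS) _ _ _ _; [apply: over | apply: hx].
have capT S M N : Th S -> submod D M -> submod D N ->
    (M ** S) 1 -> (N ** S) 1 -> (capI M N ** S) 1.
  move=> hS hM hN h1 h2; have [sS DS dS] := hC.1 S hS.
  by have := prodI_cap (c := idfun) hD sS dS; rewrite !imI_id => ->.
have JT : (J l ** T) 1.
  elim: l {hl JT'} => [|S l' IH].
    by apply: prodI_mono (DDT T hT) => // d hd; split.
  have : (capI (J l') (fun d => Th S -> S <> T -> S (d / b)) ** T) 1.
    case: (classic (Th S /\ S <> T)) => [[hS n]|n].
      apply: (@prodI_mono _ (capI (J l') (fun d => S (d / b))) _ T T) => //.
        by move=> d [h1 h2].
      apply: capT => //; first by apply: divided_submod; [apply: sub | apply: over].
      by apply: divided_local => //; [apply: sub | apply: full].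
    apply: prodI_mono IH => // d hd; split=> // h1 h2; case: n; split=> //.
  by apply: prodI_mono => // d [[hd h1] h2]; split=> // S' [<-|hi]; [apply: h2 | apply: h1].
have IS S : Th S -> S <> T -> (I ** S) 1.
  move=> hS n; apply: capT => //.
  - exact: submod_self.
  - by apply: divided_submod; [apply: sub | apply: over].
  - exact: DDT.
  - by apply: divided_local => //; [apply: sub | apply: full => // e; apply: n].
pose IJ x := exists e f, [/\ I e, J l f & x = e + f].
have [I0 ID IM] := sI; have [J0 JD JM] := sJ l.
have : IJ 1.
  apply: hC.2.
    split; last by move=> x [e [f [[he _] [hf _] ->]]]; apply: subrD.
    split; first by exists 0, 0; rewrite addr0.
      move=> _ _ [e [f [he hf ->]]] [e' [f' [he' hf' ->]]].
      by exists (e + e'), (f + f'); split; [apply: ID | apply: JD | ring].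
    move=> a _ ha [e [f [he hf ->]]]; exists (a * e), (a * f).
    by split; [apply: IM | apply: JM | ring].
  move=> S hS; case: (classic (S = T)) => [->|n].
    by apply: prodI_mono JT => // f hf; exists 0, f; rewrite add0r.
  by apply: prodI_mono (IS S hS n) => // e he; exists e, 0; rewrite addr0.
case=> e [f [[he h1] hf e1]]; exists e; split=> //.
have -> : 1 - e = f by rewrite e1; ring.
exact: JT'.
Qed.

(** * Classes of invertible modules and their localizations *)

(** An invertible module paired with its inverse, so that both localize and glue by the same
    arguments; [invertibleP] makes the link with fractional ideals. *)
Definition pinv (R : comNzRingType) (S I J : R -> Prop) :=
  [/\ submod S I, submod S J & I ** J = S].

Section InversePairs.
Variable R : comNzRingType.
Implicit Types S T I J : R -> Prop.

Lemma pinv_sym S I J : pinv S I J -> pinv S J I.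
Proof. by case=> h1 h2 h3; split=> //; rewrite prodIC. Qed.

Lemma pinv_self S : subring S -> pinv S S S.
Proof. by move=> hS; split; rewrite ?prodI_self //; apply: submod_self. Qed.

Lemma pinv_mul S I J I' J' : subring S ->
  pinv S I J -> pinv S I' J' -> pinv S (I ** I') (J ** J').
Proof.
move=> hS [h1 h2 h3] [h4 h5 h6]; split; try exact: submod_prodl.
by rewrite prodIACA h3 h6 prodI_self.
Qed.

Lemma submod_ext S T I : submod S I -> subring T -> submod (S ** T) (I ** T).
Proof.
move=> hI hT; have [h0 hD] := prodI_add I T; split=> // a x ha hx.
have : (S ** T ** (I ** T)) (a * x) by apply: prodI_mul.
rewrite prodIACA prodI_self //; apply: prodI_mono => //.
by apply: prodI_min; [apply: submod_add hI | case: hI].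
Qed.

Lemma pinv_ext S T I J : subring T -> pinv S I J -> pinv (S ** T) (I ** T) (J ** T).
Proof.
move=> hT [h1 h2 h3]; split; try exact: submod_ext.
by rewrite prodIACA h3 prodI_self.
Qed.

Lemma pinv_unique S I J J' : subring S -> pinv S I J -> pinv S I J' -> J = J'.
Proof.
move=> hS [h1 h2 h3] [h4 h5 h6].
by rewrite -(submod_prodI hS h2) -h6 prodIA (prodIC J) h3 prodIC submod_prodI.
Qed.

Lemma pinv_full S I J : subring S -> pinv S I J -> I ** (fun=> True) = (fun=> True).
Proof.
move=> hS [_ _ h]; apply: pred_ext => // z _.
have : (I ** J ** (fun=> True)) z.
  by rewrite h -[z]mul1r; apply: prodI_mul => //; apply: subr1.
by rewrite -prodIA; apply: prodI_mono.
Qed.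

End InversePairs.

Section Scaling.
Variable F : fieldType.
Implicit Types (x y : F) (S I J : F -> Prop).

Lemma smul_add x I : add_closed I -> add_closed (smul x I).
Proof.
move=> [h0 hD]; split; first by exists 0; rewrite mulr0.
by move=> _ _ [y [hy ->]] [z [hz ->]]; exists (y + z); rewrite mulrDr; split=> //; apply: hD.
Qed.

Lemma smulM x y I : smul x (smul y I) = smul (x * y) I.
Proof.
apply: pred_ext => [_ [_ [[z [hz ->]] ->]]|_ [z [hz ->]]].
  by exists z; rewrite mulrA.
by exists (y * z); rewrite mulrA; split=> //; exists z.
Qed.

Lemma smul1 I : smul 1 I = I.
Proof.
by apply: pred_ext => [_ [z [hz ->]]|z hz]; [rewrite mul1r | exists z; rewrite mul1r].
Qed.

Lemma smulK x I : x != 0 -> smul x^-1 (smul x I) = I.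
Proof. by move=> h; rewrite smulM mulVf // smul1. Qed.

Lemma smulKV x I : x != 0 -> smul x (smul x^-1 I) = I.
Proof. by move=> h; rewrite smulM divff // smul1. Qed.

Lemma smul_prodl x I J : smul x I ** J = smul x (I ** J).
Proof.
apply: pred_ext.
  apply: prodI_min; first exact: smul_add (prodI_add _ _).
  by move=> _ z [y [hy ->]] hz; exists (y * z); rewrite mulrA; split=> //; apply: prodI_mul.
move=> _ [y [hy ->]]; move: y hy.
apply: prodI_min; first exact: add_closed_mull (prodI_add _ _).
by move=> y z hy hz; rewrite mulrA; apply: prodI_mul => //; exists y.
Qed.

Lemma smul_prodr x I J : I ** smul x J = smul x (I ** J).
Proof. by rewrite prodIC smul_prodl prodIC. Qed.

Lemma smul_submod x S I : submod S I -> submod S (smul x I).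
Proof.
move=> hI; have [h0 hD] := smul_add x (submod_add hI); split=> // a _ ha [y [hy ->]].
by exists (a * y); split; [case: hI => _ _; apply | ring].
Qed.

Lemma pinv_smul x S I J : x != 0 -> pinv S I J -> pinv S (smul x I) (smul x^-1 J).
Proof.
move=> hx [h1 h2 h3]; split; try exact: smul_submod.
by rewrite smul_prodl smul_prodr h3 smulKV.
Qed.

End Scaling.

(** Exceptions are listed, so that they can be repaired one at a time by induction on the list. *)
Definition almost (T : Type) (Th P : T -> Prop) :=
  exists l : list T, forall t, Th t -> ~ P t -> List.In t l.

Lemma almost_mono T (Th P Q : T -> Prop) :
  (forall t, Th t -> P t -> Q t) -> almost Th P -> almost Th Q.
Proof. by move=> h [l hl]; exists l => t ht n; apply: hl => // hp; apply: n; apply: h. Qed.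

Lemma almost_and T (Th P Q : T -> Prop) :
  almost Th P -> almost Th Q -> almost Th (fun t => P t /\ Q t).
Proof.
move=> [l hl] [l' hl']; exists (List.app l l') => t ht n; apply: List.in_or_app.
case: (classic (P t)) => hp; last by left; apply: hl.
by right; apply: hl' => // hq; apply: n.
Qed.

Lemma almost_all T (Th P : T -> Prop) : (forall t, Th t -> P t) -> almost Th P.
Proof. by move=> h; exists nil => t ht n; case: n; apply: h. Qed.

Lemma almost_seq (E : eqType) T (Th : T -> Prop) (P : E -> T -> Prop) (s : seq E) :
  (forall x, x \in s -> almost Th (P x)) ->
  almost Th (fun t => forall x, x \in s -> P x t).
Proof.
elim: s => [|x s IH] h; first exact: almost_all.
have h1 := h x (mem_head _ _).
have h2 : almost Th (fun t => forall x, x \in s -> P x t).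
  by apply: IH => y hy; apply: h; rewrite inE hy orbT.
apply: almost_mono (almost_and h1 h2) => t _ [k1 k2] y.
by rewrite inE => /orP[/eqP ->|]; [apply: k1 | apply: k2].
Qed.

(** * Local-global principle for classes over an abstract ring [R0] *)

Section LocalGlobal.
Variables (K L : fieldType) (c : {rmorphism K -> L}) (D : K -> Prop).
Variables (Th : (K -> Prop) -> Prop) (Tinf : K -> Prop) (R0 : L -> Prop).

Local Notation full := (fun _ : K => True).
Local Notation R T := (R0 ** imI c T).

Hypotheses (hq : quotient_field_of D) (hC : complete D Th).
Hypothesis hind : forall T S, Th T -> Th S -> T <> S -> T ** S = full.
Hypothesis hpair : forall T, Th T -> T <> Tinf -> exists T', comp_pair D T T'.
Hypothesis hinf : Th Tinf.
Hypothesis hcpt : forall x, Tinf x -> almost Th (fun T => T x).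
Hypotheses (sR0 : subring R0) (DR0 : imI c D [<=] R0) (R0c : forall k, R0 (c k) -> D k).
(** For integer-valued polynomials [R full] is K[X]: its invertible modules are principal, and its
    units are the nonzero constants ([units]). *)
Hypothesis principal : forall A B, pinv (R full) A B ->
  exists x, x != 0 /\ A = smul x (R full).
Hypothesis units : forall x y, x != 0 -> y != 0 -> smul x (R full) = smul y (R full) ->
  exists k, k != 0 /\ x = y * c k.

Let hD : subring D. Proof. by case: hq. Qed.
Let sub T : Th T -> subring T. Proof. by case: hC => h _ /h []. Qed.
Let over T : Th T -> D [<=] T. Proof. by case: hC => h _ /h []. Qed.
Let dn T : Th T -> den D T. Proof. by case: hC => h _ /h []. Qed.
Let sfull : subring full. Proof. by []. Qed.

Lemma imI_full T : subring T -> imI c T ** imI c full = imI c full.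
Proof. by move=> hT; rewrite -imI_prodI (prodI_overring hT sfull). Qed.

Lemma imI_self T : subring T -> imI c T ** imI c T = imI c T.
Proof. by move=> hT; rewrite -imI_prodI prodI_self. Qed.

Lemma RD : R D = R0.
Proof. by apply: (submod_prodI (imI_subring c hD)); apply: submod_sub DR0 (submod_self sR0). Qed.

Lemma R_subring T : subring T -> subring (R T).
Proof. by move=> hT; apply: subring_prodI => //; apply: imI_subring. Qed.

Lemma R_imI T : subring T -> R T ** imI c T = R T.
Proof. by move=> hT; rewrite -prodIA imI_self. Qed.

Lemma R0_sub_R T : subring T -> R0 [<=] R T.
Proof. by move=> hT; apply: sub_prodI; apply: imI_subring. Qed.

Lemma imI_sub_R T : subring T -> imI c T [<=] R T.
Proof. by move=> hT; rewrite prodIC; apply: sub_prodI. Qed.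

Lemma R0_submod_D M : submod R0 M -> submod (imI c D) M.
Proof. exact: submod_sub. Qed.

Lemma R_submod_D T M : subring T -> submod (R T) M -> submod R0 M.
Proof. by move=> hT; apply: submod_sub; apply: R0_sub_R. Qed.

Lemma R_mod_imI T M : subring T -> submod (R T) M -> M ** imI c T = M.
Proof.
move=> hT hM; apply: submod_prodI; first exact: imI_subring.
exact: submod_sub (imI_sub_R hT) hM.
Qed.

Lemma pinv_imI T I J : pinv T I J -> pinv (imI c T) (imI c I) (imI c J).
Proof. by case=> h1 h2 h3; split; rewrite -?imI_prodI ?h3 //; apply: imI_submod. Qed.

(* For [R T]-modules: equality of classes in [Pic(R T)] modulo the image of [Pic(T)]. *)
Definition rel T (I J : L -> Prop) := exists x I0 J0,
  [/\ x != 0, pinv T I0 J0 & I = smul x (J ** imI c I0)].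

Lemma rel_refl T J : subring T -> J ** imI c T = J -> rel T J J.
Proof.
move=> hT hJ; exists 1, T, T; split; [exact: oner_neq0 | exact: pinv_self |].
by rewrite hJ smul1.
Qed.

Lemma rel_sym T I J : J ** imI c T = J -> rel T I J -> rel T J I.
Proof.
move=> hJ [x [I0 [J0 [hx h0 ->]]]]; exists x^-1, J0, I0; split.
- by rewrite invr_neq0.
- exact: pinv_sym.
- rewrite smul_prodl smulK // -prodIA -imI_prodI.
  by case: h0 => _ _ ->; rewrite hJ.
Qed.

Lemma rel_mul T I J I' J' : subring T -> rel T I J -> rel T I' J' -> rel T (I ** I') (J ** J').
Proof.
move=> hT [x [I0 [J0 [hx h0 ->]]]] [y [I1 [J1 [hy h1 ->]]]].
exists (x * y), (I0 ** I1), (J0 ** J1); split; first by rewrite mulf_neq0.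
  exact: pinv_mul.
by rewrite smul_prodl smul_prodr smulM prodIACA imI_prodI.
Qed.

Lemma rel_trans T I J M : subring T -> rel T I J -> rel T J M -> rel T I M.
Proof.
move=> hT [x [I0 [J0 [hx h0 ->]]]] [y [I1 [J1 [hy h1 ->]]]].
exists (x * y), (I1 ** I0), (J1 ** J0); split; first by rewrite mulf_neq0.
  exact: pinv_mul.
by rewrite smul_prodl smulM imI_prodI prodIA.
Qed.

Lemma rel_scale T x I J : subring T -> J ** imI c T = J -> x != 0 -> I = smul x J -> rel T I J.
Proof.
by move=> hT hJ hx ->; exists x, T, T; split=> //; [apply: pinv_self | rewrite hJ].
Qed.

Lemma rel_ext T I J : subring T -> D [<=] T -> rel D I J -> rel T (I ** imI c T) (J ** imI c T).
Proof.
move=> hT DT [x [I0 [J0 [hx h0 ->]]]]; exists x, (I0 ** T), (J0 ** T); split=> //.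
  by rewrite -[T in pinv T](prodI_overring hD hT DT); apply: pinv_ext.
by rewrite smul_prodl imI_prodI prodIACA imI_self // -!prodIA.
Qed.

Lemma generic_free T x I J : subring T -> pinv T I J ->
  smul x (R T ** imI c I) ** imI c full = smul x (R full).
Proof.
move=> hT h; rewrite smul_prodl -!prodIA -imI_prodI (pinv_full hT h).
by rewrite imI_full.
Qed.

(** Localization at [T] commutes with the intersection of [R0] and K, which is [D]. *)
Lemma R_cap_const T : Th T -> capI (R T) (imI c full) = imI c T.
Proof.
move=> hT; have sT := sub hT.
have -> : capI (R T) (imI c full) = capI (R0 ** imI c T) (imI c full ** imI c T).
  by rewrite (prodIC (imI c full)) imI_full.
rewrite -(prodI_cap hD sT (dn hT)).
- have -> : capI R0 (imI c full) = imI c D.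
    apply: pred_ext => z; first
      by move=> [h [k [_ e]]]; exists k; split=> //; apply: R0c; rewrite -e.
    by move=> hz; split; [apply: DR0 | apply: imI_mono hz].
  by rewrite -imI_prodI prodI_overring //; apply: over.
- exact: submod_sub DR0 (submod_self sR0).
- by apply: imI_submod.
Qed.

(** For [z] in the intersection, z J consists of constants of [R T], that is, of elements of [T];
    expanding 1 in I J puts [z] back in [I]. *)
Lemma R_mod_cap_const T I J : Th T -> pinv T I J ->
  capI (R T ** imI c I) (imI c full) = imI c I.
Proof.
move=> hT hI; have sT := sub hT; have [mI mJ e] := pinv_imI hI.
have [_ hsJ _] := hI.
apply: pred_ext => z; last first.
  move=> hz; split; last exact: imI_mono hz.
  by rewrite prodIC; apply: sub_prodI hz; apply: R_subring.
move=> [h1 h2]; rewrite -[z]mulr1.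
have : (imI c I ** imI c J) 1 by rewrite e; apply: subr1; apply: imI_subring.
move: (1 : L); apply: prodI_min; first by apply: add_closed_mull; exact: submod_add mI.
move=> i j hi hj; rewrite mulrCA mulrC; case: mI => _ _; apply=> //.
rewrite -R_cap_const //; split.
  have : (R T ** imI c I ** imI c J) (z * j) by apply: prodI_mul.
  by rewrite -prodIA e R_imI.
have : (imI c full ** imI c full) (z * j) by apply: prodI_mul => //; apply: imI_mono hj.
by rewrite imI_self.
Qed.

(** Once the scalar no longer depends on the member, the intersections of I' and J' with K are
    mutually inverse over [D], and I' is extended from the first. Both are identities of modules,
    checked at each member, where intersecting with K commutes with localization. *)
Lemma rel_local_global I J : pinv R0 I J ->
  (forall T, Th T -> rel T (I ** imI c T) (R T)) -> rel D I R0.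
Proof.
move=> hI h; have [x1 [I1 [J1 [hx1 h1 e1]]]] := h _ hinf.
have ge : I ** imI c full = smul x1 (R full).
  by rewrite -(generic_free x1 (sub hinf) h1) -e1 -prodIA imI_full //; apply: sub.
pose I' := smul x1^-1 I; pose J' := smul x1 J.
have hI' : pinv R0 I' J'.
  by rewrite /J' -[x1 in smul x1 J]invrK; apply: pinv_smul => //; rewrite invr_neq0.
have loc T : Th T -> exists IT JT, [/\ pinv T IT JT, I' ** imI c T = R T ** imI c IT
    & J' ** imI c T = R T ** imI c JT].
  move=> hT; have sT := sub hT; have [x [I0 [J0 [hx h0 e0]]]] := h _ hT.
  (* Both scalars generate the generic localization of [I], so they differ by a constant [k], which
     moves into the ideal [smul k I0]. *)
  have /units [//|//|k [hk ek]] : smul x (R full) = smul x1 (R full).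
    by rewrite -ge -(generic_free x sT h0) -e0 -prodIA imI_full.
  exists (smul k I0), (smul k^-1 J0).
  have hp : pinv T (smul k I0) (smul k^-1 J0) by apply: pinv_smul.
  have eI : I' ** imI c T = R T ** imI c (smul k I0).
    rewrite smul_prodl e0 smulM ek mulrA mulVf // mul1r.
    rewrite -smul_prodr; congr (_ ** _); apply: pred_ext.
      by move=> _ [_ [[y [hy ->]] ->]]; exists (k * y); rewrite rmorphM; split=> //; exists y.
    by move=> _ [_ [[y [hy ->]] ->]]; exists (c y); rewrite rmorphM; split=> //; exists y.
  split=> //; apply: (pinv_unique (R_subring sT)).
    by apply: pinv_ext; [apply: imI_subring | apply: hI'].
  rewrite eI; have := pinv_ext (R_subring sT) (pinv_imI hp).
  by rewrite ![_ ** R T]prodIC R_imI.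
have [mI' mJ' eIJ'] := hI'.
have capT M MT NT T : Th T -> submod R0 M -> pinv T MT NT -> M ** imI c T = R T ** imI c MT ->
    imI c (fun k => M (c k)) ** imI c T = imI c MT.
  move=> hT hM hMT e; rewrite imI_preim (prodI_cap hD (sub hT) (dn hT)).
  - by rewrite e [imI c full ** _]prodIC imI_full ?(R_mod_cap_const hT hMT) //; apply: sub.
  - exact: R0_submod_D.
  - exact: imI_submod.
pose A k := I' (c k); pose B k := J' (c k).
exists x1, A, B; split=> //.
  have mA : submod D A by apply: preim_submod; apply: R0_submod_D.
  have mB : submod D B by apply: preim_submod; apply: R0_submod_D.
  split=> //; apply: (imI_eq (c := c)); first exact: fmorph_inj.
  apply: (complete_eq (c := c) hD hC).
  - by apply: imI_submod; apply: submod_prodl.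
  - by apply: imI_submod; apply: submod_self.
  move=> T hT; have [IT [JT [hp e2 e3]]] := loc T hT; have sT := sub hT.
  have hp' : pinv T JT IT by apply: pinv_sym.
  rewrite imI_prodI -(imI_self sT) prodIACA.
  rewrite (capT _ _ _ _ hT mI' hp e2) (capT _ _ _ _ hT mJ' hp' e3) imI_self //.
  rewrite -!imI_prodI; case: hp => _ _ ->.
  by rewrite prodI_overring //; apply: over.
rewrite -[I](smulKV I hx1) -/I'; congr smul.
apply: (complete_eq (c := c) hD hC).
- exact: R0_submod_D.
- by apply: R0_submod_D; apply: submod_prodl; apply: submod_self.
move=> T hT; have [IT [JT [hp e2 e3]]] := loc T hT; have sT := sub hT.
have [mT _ _] := pinv_imI hp.
rewrite e2 -[RHS]prodIA (capT _ _ _ _ hT mI' hp e2) -prodIA (prodIC (imI c T)).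
by rewrite (submod_prodI (imI_subring c sT) mT).
Qed.

(** * Gluing of modules and lifting of finitely many classes *)

(** [G] is the intersection of [A] and M T'. At [T] the second module becomes generic and contains
    [A]; at [T'] the first becomes generic and M T' remains. Any other member contains [T'], so
    localizing there factors through [T']. *)
Lemma glue T A M : Th T -> T <> Tinf -> submod R0 A -> submod R0 M ->
  A ** imI c T = A -> A ** imI c full = R full -> M ** imI c full = R full ->
  exists G, [/\ submod R0 G, G ** imI c T = A &
    forall S, Th S -> S <> T -> G ** imI c S = M ** imI c S].
Proof.
move=> hT nT hA hM eA gA gM; have [T' hP] := hpair hT nT.
have [sT sT' DT DT' _] := hP; have dT' := pair_den hq hP.
have TT' : imI c T ** imI c T' = imI c full by rewrite -imI_prodI (pair_full hq hP).
have hMT' : submod R0 (M ** imI c T') by apply: submod_prodl.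
have upT S N : N ** imI c S [<=] N ** imI c full.
  by apply: prodI_mono => // z; apply: imI_mono.
exists (capI A (M ** imI c T')).
have [mA mM] := (R0_submod_D hA, R0_submod_D hMT').
split; first exact: submod_cap.
  rewrite (prodI_cap hD sT (dn hT) mA mM) eA -prodIA (prodIC (imI c T')) TT' gM -gA.
  apply: pred_ext; first by move=> z [].
  by move=> z hz; split=> //; rewrite -eA in hz; apply: upT hz.
have GT' : capI A (M ** imI c T') ** imI c T' = M ** imI c T'.
  rewrite (prodI_cap hD sT' dT' mA mM) -prodIA imI_self // -[A]eA -prodIA TT' gA -gM.
  apply: pred_ext; first by move=> z [].
  by move=> z hz; split=> //; apply: upT hz.
move=> S hS nS; have T'S : T' [<=] S.
  apply: (pair_sub_other hq hP); [exact: sub | exact: over | apply: hind => // e].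
  by apply: nS.
have eS : imI c S = imI c T' ** imI c S by rewrite -imI_prodI prodI_overring //; apply: sub.
by rewrite eS prodIA GT' -prodIA.
Qed.

Lemma prodI_imI T I J : subring T -> I ** J ** imI c T = (I ** imI c T) ** (J ** imI c T).
Proof. by move=> hT; rewrite prodIACA imI_self. Qed.

Lemma pinv_R T I J : subring T -> pinv R0 I J -> pinv (R T) (I ** imI c T) (J ** imI c T).
Proof. by move=> hT; apply: pinv_ext; apply: imI_subring. Qed.

Lemma R_full T : subring T -> R T ** imI c full = R full.
Proof. by move=> hT; rewrite -prodIA imI_full. Qed.

(** A generator of the generic localization of [A] is divided out; the inverse then has generic
    localization [R full] too, as the inverse of [R full]. *)
Lemma normalize T A B : subring T -> pinv (R T) A B ->
  exists x, [/\ x != 0, pinv (R T) (smul x A) (smul x^-1 B),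
    smul x A ** imI c full = R full & smul x^-1 B ** imI c full = R full].
Proof.
move=> hT hA; have hF := pinv_ext (imI_subring c sfull) hA.
rewrite R_full // in hF; have [x [hx e]] := principal hF.
exists x^-1; have h1 : pinv (R T) (smul x^-1 A) (smul x^-1^-1 B).
  by apply: pinv_smul => //; rewrite invr_neq0.
have e1 : smul x^-1 A ** imI c full = R full by rewrite smul_prodl e smulK.
split=> //; first by rewrite invr_neq0.
have := pinv_ext (imI_subring c sfull) h1; rewrite R_full // e1 => -[_ m e2].
by rewrite -(submod_prodI (R_subring sfull) m) prodIC.
Qed.

Lemma R_submod_imI T A : subring T -> submod (R T) A -> submod R0 A /\ A ** imI c T = A.
Proof. by move=> hT hA; split; [apply: R_submod_D hA | apply: R_mod_imI hA]. Qed.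

Lemma pinv_of_local G H : submod R0 G -> submod R0 H ->
  (forall T, Th T -> (G ** imI c T) ** (H ** imI c T) = R T) -> pinv R0 G H.
Proof.
move=> hG hH h; split=> //; apply: (complete_eq (c := c) hD hC).
- by apply: R0_submod_D; apply: submod_prodl.
- by apply: R0_submod_D; apply: submod_self.
by move=> T hT; rewrite prodI_imI ?h //; apply: sub.
Qed.

(** Multiplication by the inverse [J'] reduces to comparison with the trivial class. *)
Lemma rel_of_local I J I' J' : pinv R0 I J -> pinv R0 I' J' ->
  (forall T, Th T -> rel T (I ** imI c T) (I' ** imI c T)) -> rel D I I'.
Proof.
move=> hI hI' h; have [mI _ _] := hI; have [mI' mJ' e] := hI'.
have h1 : rel D (I ** J') R0.
  apply: rel_local_global; first exact: pinv_mul hI (pinv_sym hI').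
  move=> T hT; have sT := sub hT; rewrite -[in X in rel _ _ X]e !prodI_imI //.
  apply: rel_mul => //; first exact: h.
  by apply: rel_refl => //; rewrite -prodIA imI_self.
have h2 : rel D I' I'.
  exact: rel_refl hD (submod_prodI (imI_subring c hD) (R0_submod_D mI')).
have := rel_mul hD h1 h2; rewrite -prodIA [J' ** I']prodIC e (submod_prodI sR0 mI).
by rewrite prodIC (submod_prodI sR0 mI').
Qed.

(** The module and its inverse, once normalized, are glued separately to [R0]; the results are
    mutually inverse because they are so at each member. *)
Lemma lift_single T A B : Th T -> T <> Tinf -> pinv (R T) A B ->
  exists I J, [/\ pinv R0 I J, rel T (I ** imI c T) A &
    forall S, Th S -> S <> T -> I ** imI c S = R S].
Proof.
move=> hT nT hA; have sT := sub hT; have [x [hx hA1 gA gB]] := normalize sT hA.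
have [mA mB eAB] := hA1; have m0 := submod_self sR0.
have [mA0 eA] := R_submod_imI sT mA; have [mB0 eB] := R_submod_imI sT mB.
have [G [mG eG lG]] := glue hT nT mA0 m0 eA gA erefl.
have [H [mH eH lH]] := glue hT nT mB0 m0 eB gB erefl.
exists G, H; split=> //.
  apply: pinv_of_local => // S hS; case: (classic (S = T)) => [->|n].
    by rewrite eG eH.
  by rewrite lG // lH // prodI_self //; apply: R_subring; apply: sub.
rewrite eG; apply: (rel_scale (x := x)) => //.
by case: hA => mA' _ _; apply: R_mod_imI.
Qed.

Lemma lift_finite (l : list (K -> Prop)) (s : (K -> Prop) -> L -> Prop) :
  (forall T, Th T -> T <> Tinf -> exists B, pinv (R T) (s T) B) ->
  (forall T, Th T -> T <> Tinf -> ~ rel T (s T) (R T) -> List.In T l) ->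
  exists I J, [/\ pinv R0 I J,
    forall T, Th T -> T <> Tinf -> rel T (I ** imI c T) (s T) &
    rel Tinf (I ** imI c Tinf) (R Tinf)].
Proof.
elim: l s => [|T l IH] s hs hl.
  exists R0, R0; split; first exact: pinv_self.
    move=> T hT nT; apply: rel_sym; first by apply: R_imI; apply: sub.
    by apply: NNPP => n; case: (hl T hT nT n).
  by apply: rel_refl; [apply: sub | apply: R_imI; apply: sub].
have [[hT nT]|nT] := classic (Th T /\ T <> Tinf); last first.
  by apply: IH => // S hS nS n; case: (hl S hS nS n) => // e; case: nT; rewrite e.
have modR S A B : Th S -> pinv (R S) A B -> A ** R S = A.
  by move=> hS [mA _ _]; apply: submod_prodI => //; apply: R_subring; apply: sub.
have [B hB] := hs T hT nT; have [I2 [J2 [h2 r2 e2]]] := lift_single hT nT hB.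
(* [s'] trivializes the family at [T], so the shorter list serves for it; the class at [T] is
   restored by the factor [I2], which is trivial at all other members. *)
have [s' [s'T s'n]] : exists s', s' T = R T /\ forall S, S <> T -> s' S = s S.
  exists (fun S => if excluded_middle_informative (S = T) then R T else s S).
  by split=> [|S n]; case: excluded_middle_informative => // n; case: n.
have [||I1 [J1 [h1 r1 i1]]] := IH s'.
- move=> S hS nS; case: (classic (S = T)) => [->|n]; last by rewrite s'n //; apply: hs.
  by rewrite s'T; exists (R T); apply: pinv_self; apply: R_subring; apply: sub.
- move=> S hS nS; case: (classic (S = T)) => [->|n].
    by rewrite s'T => n; case: n; apply: rel_refl; [apply: sub | apply: R_imI; apply: sub].
  by rewrite s'n // => k; case: (hl S hS nS k) => // e; case: n.
exists (I1 ** I2), (J1 ** J2); split; first exact: pinv_mul.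
  move=> S hS nS; rewrite prodI_imI; last exact: sub.
  have [B' hB'] := hs S hS nS; rewrite -(modR S (s S) B') // [s S ** _]prodIC.
  have := r1 S hS nS; case: (classic (S = T)) => [->|n].
    by rewrite s'T => r; apply: rel_mul => //; apply: sub.
  rewrite s'n // => r; rewrite [R S ** _]prodIC; apply: rel_mul => //; [exact: sub | rewrite e2 //].
  by apply: rel_refl; [apply: sub | apply: R_imI; apply: sub].
rewrite prodI_imI; last exact: sub.
rewrite -[R Tinf](prodI_self (R_subring (sub hinf))).
apply: rel_mul => //; [exact: sub | rewrite e2 //; last by move=> e; apply: nT].
by apply: rel_refl; [apply: sub | apply: R_imI; apply: sub].
Qed.

(** * Passing from the pointed member to almost all members *)

(** An element of the localization at T_oo involves finitely many elements of [Tinf], each of which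
    lies in almost all members. *)
Lemma spread M z : (M ** imI c Tinf) z -> almost Th (fun T => (M ** imI c T) z).
Proof.
move: z; apply: prodI_min; first split.
- by apply: almost_all => T _; case: (prodI_add M (imI c T)).
- move=> x y hx hy; apply: almost_mono (almost_and hx hy) => T _ [h1 h2].
  by case: (prodI_add M (imI c T)) => _; apply.
move=> m _ hm [t [ht ->]]; apply: almost_mono (hcpt ht) => T _ h.
by apply: prodI_mul => //; exists t.
Qed.

(** I is contained in I (s1 s2), hence in s1 (I J) = s1 S. *)
Lemma pinv_span (F : comNzRingType) (S I J : F -> Prop) s1 s2 : subring S -> pinv S I J ->
  mem_seq s1 [<=] I -> mem_seq s2 [<=] J -> (mem_seq s1 ** mem_seq s2) 1 ->
  I = mem_seq s1 ** S.
Proof.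
move=> hS [mI mJ e] h1 h2 h; apply: pred_ext.
  move=> z hz; have : (I ** (mem_seq s1 ** mem_seq s2)) z.
    by rewrite -[z]mulr1; apply: prodI_mul.
  by rewrite prodIA (prodIC I) -prodIA -e; apply: prodI_mono => // w; apply: prodI_mono.
by rewrite -[I](submod_prodI hS mI); apply: prodI_mono.
Qed.

(** The inclusion of the inverses gives the missing one: X = X A B is contained in (X Y) A = A. *)
Lemma pinv_le (F : comNzRingType) (S A B X Y : F -> Prop) : subring S ->
  pinv S A B -> pinv S X Y -> A [<=] X -> B [<=] Y -> A = X.
Proof.
move=> hS [mA mB eA] [mX mY eX] hA hB; apply: pred_ext => // z hz.
have : (X ** (A ** B)) z by rewrite eA submod_prodI.
rewrite prodIA prodIAC => h; have : (X ** Y ** A) z.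
  by apply: prodI_mono h => // w; apply: prodI_mono.
by rewrite eX prodIC submod_prodI.
Qed.

Lemma almost_products (F : comNzRingType) (P : F -> (K -> Prop) -> Prop) (s1 s2 : seq F) :
  (forall x y, x \in s1 -> y \in s2 -> almost Th (P (x * y))) ->
  almost Th (fun T => forall x y, x \in s1 -> y \in s2 -> P (x * y) T).
Proof.
move=> h; have : almost Th (fun T => forall x, x \in s1 -> forall y, y \in s2 -> P (x * y) T).
  by apply: almost_seq => x hx; apply: almost_seq => y hy; apply: h.
by apply: almost_mono => T _ k x y hx hy; apply: k.
Qed.

(** Triviality at T_oo rests on finitely many memberships: generators of I' and J' lie in the
    modules spanned by generators of [I0] and [J0], and products of the latter lie in [Tinf]. These
    persist at almost all members, where [pinv_le] turns the inclusions into an equality. *)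
Lemma rel_finite_support I J : pinv R0 I J -> rel Tinf (I ** imI c Tinf) (R Tinf) ->
  almost Th (fun T => rel T (I ** imI c T) (R T)).
Proof.
move=> hI [x [I0 [J0 [hx h0 e0]]]]; have sI := sub hinf; have sR := R_subring sI.
pose I' := smul x^-1 I; pose J' := smul x J.
have hI' : pinv R0 I' J'.
  by rewrite /J' -[x in smul x J]invrK; apply: pinv_smul => //; rewrite invr_neq0.
have hI'inf := pinv_R sI hI'.
have eI' : I' ** imI c Tinf = R Tinf ** imI c I0 by rewrite smul_prodl e0 smulK.
have hRI0 : pinv (R Tinf) (R Tinf ** imI c I0) (R Tinf ** imI c J0).
  have := pinv_ext sR (pinv_imI h0); rewrite ![_ ** R Tinf]prodIC R_imI //.
have eJ' : J' ** imI c Tinf = R Tinf ** imI c J0.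
  by apply: (pinv_unique sR hI'inf); rewrite eI'.
have [s1 [s2 [h1 h2 h12]]] : exists s1 s2, [/\ mem_seq s1 [<=] I', mem_seq s2 [<=] J'
    & (mem_seq s1 ** mem_seq s2) 1].
  by apply: fg_sub; case: hI' => _ _ ->; apply: subr1.
have [s3 [s4 [h3 h4 h34]]] : exists s1 s2, [/\ mem_seq s1 [<=] I0, mem_seq s2 [<=] J0
    & (mem_seq s1 ** mem_seq s2) 1].
  by apply: fg_sub; case: h0 => _ _ ->; apply: subr1.
have e3 := pinv_span sI h0 h3 h4 h34.
have e4 : J0 = mem_seq s4 ** Tinf.
  by apply: pinv_span h4 h3 _ => //; [apply: pinv_sym | rewrite prodIC].
have e1 := pinv_span sR0 hI' h1 h2 h12.
have e2 : J' = mem_seq s2 ** R0.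
  by apply: pinv_span h2 h1 _ => //; [apply: pinv_sym | rewrite prodIC].
have RS T s : subring T -> R T ** imI c (mem_seq s ** T) = R0 ** imI c (mem_seq s) ** imI c T.
  by move=> sT; rewrite imI_prodI prodIACA imI_self.
have inI' u : u \in s1 -> (R0 ** imI c (mem_seq s3) ** imI c Tinf) u.
  by move=> hu; rewrite -RS // -e3 -eI'; apply: sub_prodI; [apply: imI_subring | apply: h1].
have inJ' u : u \in s2 -> (R0 ** imI c (mem_seq s4) ** imI c Tinf) u.
  by move=> hu; rewrite -RS // -e4 -eJ'; apply: sub_prodI; [apply: imI_subring | apply: h2].
have a1 := almost_seq (fun u hu => spread (inI' u hu)).
have a2 := almost_seq (fun u hu => spread (inJ' u hu)).
have a3 : almost Th (fun T => forall a b, a \in s3 -> b \in s4 -> T (a * b)).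
  apply: almost_products (fun x T => T x) _ _ _ => a b ha hb; apply: hcpt.
  by case: h0 => _ _ <-; apply: prodI_mul; [apply: h3 | apply: h4].
apply: almost_mono (almost_and a1 (almost_and a2 a3)) => T hT [k1 [k2 k3]].
have sT := sub hT.
(* The generators of [I0] and [J0], now over [T]: 1 is still a sum of their products, and [k3] keeps
   these products in [T]. *)
pose IT := mem_seq s3 ** T; pose JT := mem_seq s4 ** T.
have hIT : pinv T IT JT.
  split; try exact: submod_prodS.
  rewrite /IT /JT prodIACA prodI_self // prodIC; apply: pred_ext.
    apply: prodI_min; first exact: submod_add (submod_self sT).
    move=> t w ht hw; apply: (subrM sT ht); move: w hw.
    by apply: prodI_min; [apply: submod_add (submod_self sT) | move=> a b; apply: k3].
  by move=> z hz; rewrite -[z]mulr1; apply: prodI_mul.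
have hX : pinv (R T) (R T ** imI c IT) (R T ** imI c JT).
  have := pinv_ext (R_subring sT) (pinv_imI hIT); rewrite ![_ ** R T]prodIC R_imI //.
have eT : I' ** imI c T = R T ** imI c IT.
  have [mX mY _] := hX.
  apply: (pinv_le (R_subring sT) (pinv_R sT hI') hX).
    rewrite e1 -prodIA; apply: prodI_min; first exact: submod_add mX.
    move=> u r hu hr; rewrite mulrC; case: mX => _ _; apply=> //.
    by rewrite RS //; apply: k1.
  rewrite e2 -prodIA; apply: prodI_min; first exact: submod_add mY.
  move=> u r hu hr; rewrite mulrC; case: mY => _ _; apply=> //.
  by rewrite RS //; apply: k2.
exists x, IT, JT; split=> //.
by rewrite -eT -smul_prodl smulKV.
Qed.

(** At an exceptional member both modules are replaced by [R T], which removes it from the list and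
    leaves the localizations at T_oo untouched. *)
Lemma glue_finite (l : list (K -> Prop)) G H : submod R0 G -> submod R0 H ->
  G ** imI c full = R full -> H ** imI c full = R full ->
  (G ** imI c Tinf) ** (H ** imI c Tinf) = R Tinf ->
  (forall T, Th T -> (G ** imI c T) ** (H ** imI c T) <> R T -> List.In T l) ->
  exists I J, pinv R0 I J /\ I ** imI c Tinf = G ** imI c Tinf.
Proof.
elim: l G H => [|T l IH] G H mG mH gG gH hi hl.
  exists G, H; split=> //; apply: pinv_of_local => // T hT.
  by apply: NNPP => n; case: (hl T hT n).
have [[hT nT]|nT] := classic (Th T /\ T <> Tinf); last first.
  apply: (IH G H) => // S hS n; case: (hl S hS n) => // e; case: nT; rewrite e; split=> //.
  by move=> e'; apply: n; rewrite e'.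
have sT := sub hT; have mR : submod R0 (R T) by apply: submod_prodl; apply: submod_self.
have [G1 [mG1 eG lG]] := glue hT nT mR mG (R_imI sT) (R_full sT) gG.
have [H1 [mH1 eH lH]] := glue hT nT mR mH (R_imI sT) (R_full sT) gH.
have nI : Tinf <> T by move=> e; apply: nT.
rewrite -(lG _ hinf nI).
apply: (IH G1 H1) => //.
- by rewrite -{1}(imI_full sT) prodIA eG R_full.
- by rewrite -{1}(imI_full sT) prodIA eH R_full.
- by rewrite lG // lH.
move=> S hS; case: (classic (S = T)) => [->|n].
  by rewrite eG eH prodI_self //; apply: R_subring.
by rewrite lG // lH // => k; case: (hl S hS k) => // e; case: n.
Qed.

(** Finitely many generators of the normalized [A] and of its inverse span modules over [R0] that
    are mutually inverse at T_oo and, by [spread], at almost all members; [glue_finite] repairs the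
    rest. *)
Lemma lift_infinity A B : pinv (R Tinf) A B ->
  exists I J, pinv R0 I J /\ rel Tinf (I ** imI c Tinf) A.
Proof.
move=> hA; have sI := sub hinf; have sR := R_subring sI.
have [x [hx hA1 gA gB]] := normalize sI hA.
have [s1 [s2 [h1 h2 h12]]] : exists s1 s2, [/\ mem_seq s1 [<=] smul x A,
    mem_seq s2 [<=] smul x^-1 B & (mem_seq s1 ** mem_seq s2) 1].
  by apply: fg_sub; case: hA1 => _ _ ->; apply: subr1.
have e1 := pinv_span sR hA1 h1 h2 h12.
have e2 : smul x^-1 B = mem_seq s2 ** R Tinf.
  by apply: pinv_span h2 h1 _ => //; [apply: pinv_sym | rewrite prodIC].
have [mA1 mB1 eAB] := hA1.
have [l hl] : almost Th (fun T => forall a b, a \in s1 -> b \in s2 -> R T (a * b)).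
  apply: almost_products (fun x T => R T x) _ _ _ => a b ha hb; apply: spread.
  by rewrite -eAB; apply: prodI_mul; [apply: h1 | apply: h2].
have [||||||I [J [hI e]]] := @glue_finite l (mem_seq s1 ** R0) (mem_seq s2 ** R0).
- exact: submod_prodS.
- exact: submod_prodS.
- by rewrite -{1}(imI_full sI) prodIA -(prodIA (mem_seq s1)) -e1.
- by rewrite -{1}(imI_full sI) prodIA -(prodIA (mem_seq s2)) -e2.
- by rewrite -(prodIA (mem_seq s1)) -(prodIA (mem_seq s2)) -e1 -e2.
- move=> T hT n; apply: hl => // k; apply: n; have sT := sub hT.
  rewrite -(prodIA (mem_seq s1)) -(prodIA (mem_seq s2)) prodIACA (prodI_self (R_subring sT)).
  rewrite prodIC; apply: pred_ext.
    apply: prodI_min; first by apply: submod_add (submod_self (R_subring sT)).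
    move=> r w hr hw; apply: (subrM (R_subring sT) hr); move: w hw.
    by apply: prodI_min; [apply: submod_add (submod_self (R_subring sT)) | move=> a b; apply: k].
  by move=> z hz; rewrite -[z]mulr1; apply: prodI_mul.
exists I, J; split=> //; rewrite e -prodIA -e1; apply: rel_scale hx _ => //.
by case: hA => mA _ _; apply: R_mod_imI.
Qed.

End LocalGlobal.

(** * Integer-valued polynomials *)

Section IntegerValued.
Variables (K : fieldType) (D : K -> Prop).
Hypothesis hq : quotient_field_of D.
Let hD : subring D. Proof. by case: hq. Qed.

Lemma subring_horner (S : K -> Prop) (p : {poly K}) x :
  subring S -> (forall i, S p`_i) -> S x -> S p.[x].
Proof.
move=> hS hp hx; have [S0 SD _] := submod_self hS; rewrite horner_coef.
apply: big_ind => // i _; apply: subrM => //.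
by elim: (i : nat) => [|n IH]; rewrite ?expr0 ?exprS; [apply: subr1 | apply: subrM].
Qed.

Lemma horner_congr (S : K -> Prop) (p : {poly K}) x y :
  subring S -> (forall i, S p`_i) -> S x -> S y ->
  exists h, S h /\ p.[x] - p.[y] = (x - y) * h.
Proof.
move=> hS + hx hy; elim/poly_ind: p => [|p k IH] hp.
  by exists 0; rewrite !horner0 subrr mulr0; split=> //; apply: subr0.
have hp' i : S p`_i by have := hp i.+1; rewrite coefD coefMX coefC addr0.
have [h [hh e]] := IH hp'; exists (h * x + p.[y]); split.
  by apply: subrD => //; [apply: subrM | apply: subring_horner].
rewrite !hornerMXaddC (_ : _ - _ = (p.[x] - p.[y]) * x + p.[y] * (x - y)); last by ring.
by rewrite e; ring.
Qed.

Lemma clear_denominators (p : {poly K}) :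
  exists b, [/\ D b, b != 0 & forall i, D (b * p`_i)].
Proof.
elim/poly_ind: p => [|p k [b [hb b0 h]]].
  by exists 1; split; rewrite ?oner_eq0 //; [apply: subr1 | move=> i; rewrite coef0 mulr0; apply: subr0].
case: hq => _ /(_ k) [a [s [ha hs s0 ek]]]; exists (b * s); split.
- exact: subrM.
- by rewrite mulf_neq0.
- move=> i; rewrite coefD coefMX coefC; case: i => [|i] /=.
    rewrite add0r ek (_ : _ * _ = b * a); last by field.
    exact: subrM.
  by rewrite addr0 mulrAC; apply: subrM.
Qed.

Lemma Int_subring (S : K -> Prop) : subring S -> subring (Int S).
Proof.
move=> hS; split.
- by move=> a _; rewrite horner0; apply: subr0.
- by move=> a _; rewrite hornerC; apply: subr1.
- by move=> p q hp hq' a ha; rewrite hornerD hornerN; apply: subrB; [|apply: hp|apply: hq'].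
- by move=> p q hp hq' a ha; rewrite hornerM; apply: subrM; [|apply: hp|apply: hq'].
Qed.

Lemma Int_coef (p : {poly K}) : (forall i, D p`_i) -> Int D p.
Proof. by move=> h a ha; apply: subring_horner. Qed.

Lemma IntT_coef (S : K -> Prop) (p : {poly K}) :
  (forall i, S p`_i) -> (Int D ** imI polyC S) p.
Proof.
move=> h; rewrite -[p]coefK poly_def; have [M0 MD] := prodI_add (Int D) (imI polyC S).
apply: big_ind => // i _; rewrite -mul_polyC mulrC; apply: prodI_mul; last exact: imI_mem.
by apply: Int_coef => j; rewrite coefXn; case: eqP => _; [apply: subr1 | apply: subr0].
Qed.

Lemma Int_pair T T' : comp_pair D T T' -> Int T = Int D ** imI polyC T.
Proof.
move=> hP; have [sT sT' DT DT' [hI he]] := hP.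
apply: pred_ext => f; last first.
  move: f; apply: prodI_min; first exact: submod_add (submod_self (Int_subring sT)).
  move=> f _ hf [t [ht ->]] a ha; rewrite hornerM hornerC; apply: subrM => //.
  (* [b] clears the denominators of [f], and [a] is congruent modulo b T to some [d] in [D]; so f(a)
     differs from f(d), an element of [D], by (a - d)/b times an element of [T]. *)
  have [b [hb b0 hc]] := clear_denominators f; have [d [hd hda]] := pair_approx hq hP ha hb b0.
  have hcT i : T (b *: f)`_i by rewrite coefZ; apply: DT.
  have [h [hh e]] := horner_congr sT hcT ha (DT _ hd).
  have -> : f.[a] = f.[d] + (a - d) / b * h.
    by apply: (mulfI b0); move: e; rewrite !hornerZ => e; rewrite mulrDr -[LHS](subrK (b * f.[d])) e; field; exact: b0.
  by apply: subrD => //; [apply: DT; apply: hf | apply: subrM].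
move=> hf; have [b [hb b0 hc]] := clear_denominators f.
have [e [hDe h1 h2]] := he b hb b0.
(* The factor 1 - e, divisible by [b] in [T'], brings the values on [D] into [T'], and they lie in
   [T] already; the factor e, divisible by [b] in [T], brings the coefficients into [T]. *)
have -> : f = ((1 - e) *: f) * (1 : K)%:P + e *: f.
  by rewrite mulr1 -scalerDl subrK scale1r.
have [M0 MD] := prodI_add (Int D) (imI polyC T); apply: MD.
  apply: prodI_mul; last by apply: imI_mem; apply: subr1.
  move=> a ha; rewrite hornerZ; apply: hI.
    apply: subrM => //; last by apply: hf; apply: DT.
    by apply: DT; apply: subrB => //; apply: subr1.
  have -> : (1 - e) * f.[a] = (1 - e) / b * (b *: f).[a] by rewrite hornerZ; field.
  apply: subrM => //; apply: DT'; apply: subring_horner => // i; rewrite coefZ; exact: hc.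
apply: IntT_coef => i; rewrite coefZ (_ : _ * _ = e / b * (b * f`_i)); last by field.
by apply: subrM => //; apply: DT.
Qed.

End IntegerValued.

(** * The field K(X) and the generic ring K[X] *)

Section RationalFunctions.
Variable K : fieldType.
Local Notation L := {fraction {poly K}}.
Local Notation tof := (@FracField.tofrac {poly K}).

Definition cst : {rmorphism K -> L} := tof \o (@polyC K).

Lemma constX_im (I : K -> Prop) : constX I = imI cst I.
Proof.
apply: pred_ext => z; first by move=> [_ [[k [hk ->]] ->]]; exists k.
by move=> [k [hk ->]]; exists k%:P; split=> //; exists k.
Qed.

Lemma imgX_im (S : {poly K} -> Prop) : imgX S = imI tof S.
Proof. by []. Qed.

Lemma imgX_prod (S : {poly K} -> Prop) T : imgX (S ** imI polyC T) = imgX S ** imI cst T.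
Proof.
rewrite !imgX_im imI_prodI; congr (_ ** _); apply: pred_ext => z.
  by move=> [_ [[k [hk ->]] ->]]; exists k.
by move=> [k [hk ->]]; exists k%:P; split=> //; exists k.
Qed.

Lemma fractionP (x : L) : exists a b : {poly K}, b != 0 /\ x = tof a / tof b.
Proof.
have [a [b [b0 e]]] : exists a b : {poly K}, b != 0 /\ x * tof b = tof a.
  elim/quotW: x => r; exists (frac r).1, (frac r).2; split; first exact: denom_ratioP.
  rewrite !piE; apply/eqP; rewrite piE /FracField.mulf.
  by rewrite FracField.equivfE !numden_Ratio ?(oner_eq0, mulf_neq0, denom_ratioP) // !mulr1 mulrC.
exists a, b; split=> //; rewrite -e mulfK //.
by rewrite tofrac_eq0.
Qed.

End RationalFunctions.

(** The numerator of a nonzero element y = a/b of the inverse is a common denominator, since a x = b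
    (x y). *)
Lemma invertibleP (F : fieldType) (S I : F -> Prop) : subring S ->
  (forall x, exists a b, [/\ S a, S b, b != 0 & x = a / b]) ->
  (invertible S I <-> exists J, pinv S I J).
Proof.
move=> hS hF; split.
  move=> [[mI _ _] [J [[mJ _ _] e]]]; exists J; split=> //.
  by apply: pred_ext => z; [apply: (proj1 (e z)) | apply: (proj2 (e z))].
have key A B : submod S A -> A ** B = S -> fractional S A.
  move=> mA e; split=> //.
    apply: NNPP => n; have : (A ** B) 1 by rewrite e; apply: subr1.
    have : A ** B [<=] (fun z => z = 0).
      apply: prodI_min; first by split=> // x y -> ->; rewrite addr0.
      move=> x y hx _; apply/eqP; rewrite mulf_eq0; apply/orP; left.
      by apply/negP => /negP x0; apply: n; exists x.
    by move=> h /h /eqP; rewrite oner_eq0.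
  have [y [hy y0]] : exists y, B y /\ y != 0.
    apply: NNPP => n; have : (A ** B) 1 by rewrite e; apply: subr1.
    have : A ** B [<=] (fun z => z = 0).
      apply: prodI_min; first by split=> // x y -> ->; rewrite addr0.
      move=> x y _ hy; apply/eqP; rewrite mulf_eq0; apply/orP; right.
      by apply/negP => /negP y0; apply: n; exists y.
    by move=> h /h /eqP; rewrite oner_eq0.
  have [a [b [ha hb b0 ey]]] := hF y; exists a; split=> //.
    by apply: contraNneq y0 => a0; rewrite ey a0 mul0r.
  move=> x hx; have : S (x * y) by rewrite -e; apply: prodI_mul.
  move=> h; have -> : a * x = b * (x * y) by rewrite ey; field.
  exact: subrM.
move=> [J [mI mJ e]]; split; first exact: key e.
exists J; split; first by apply: (key J I) => //; rewrite prodIC.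
by move=> z; rewrite e.
Qed.

Lemma overring_quotient (K : fieldType) (D T : K -> Prop) :
  quotient_field_of D -> subring T -> D [<=] T -> quotient_field_of T.
Proof.
move=> [_ hF] hT DT; split=> // x; have [a [b [ha hb b0 e]]] := hF x.
by exists a, b; split=> //; apply: DT.
Qed.

Lemma divf_mull (F : fieldType) (n p q : F) : n != 0 -> p / q = (n * p) / (n * q).
Proof. by move=> n0; rewrite -mulf_div divff // mul1r. Qed.

Section RationalFunctionFacts.
Variables (K : fieldType) (D : K -> Prop) (hq : quotient_field_of D).
Local Notation L := {fraction {poly K}}.
Local Notation tof := (@FracField.tofrac {poly K}).
Let hD : subring D. Proof. by case: hq. Qed.

Lemma tof_inj : injective tof.
Proof. by move=> p q /eqP; rewrite tofrac_eq => /eqP. Qed.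

Lemma Int_R_subring : subring (imgX (Int D)).
Proof. by apply: imI_subring; apply: Int_subring. Qed.

Lemma Int_R_const z : imI (cst K) D z -> imgX (Int D) z.
Proof. by move=> [k [hk ->]]; exists k%:P; split=> // a _; rewrite hornerC. Qed.

Lemma Int_R_cap k : imgX (Int D) (cst K k) -> D k.
Proof.
move=> [p [hp /tof_inj e]]; have := hp 0 (subr0 hD); rewrite -e hornerC //.
Qed.

Lemma Int_R_quotient x : exists a b : L, [/\ imgX (Int D) a, imgX (Int D) b, b != 0 & x = a / b].
Proof.
have [p [q [q0 ->]]] := fractionP x.
have [b [hb b0 hp]] := clear_denominators hq p.
have [d [hd d0 hp']] := clear_denominators hq q.
have in_R (r : {poly K}) s s' : D s' -> (forall i, D (s * r`_i)) -> imgX (Int D) (tof ((s' * s)%:P * r)).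
  move=> hs' h; exists ((s' * s)%:P * r); split=> //; apply: Int_coef => // i.
  by rewrite coefCM -mulrA; apply: subrM.
have n0 : tof (b * d)%:P != 0 by rewrite tofrac_eq0 polyC_eq0 mulf_neq0.
have n1 : tof q != 0 by rewrite tofrac_eq0.
exists (tof ((d * b)%:P * p)), (tof ((b * d)%:P * q)); split.
- exact: in_R.
- exact: in_R.
- by rewrite tofrac_eq0 mulf_neq0 // polyC_eq0 mulf_neq0.
rewrite (mulrC d b) !tofracM; exact: divf_mull n0.
Qed.

Lemma Int_R_full : imgX (Int D) ** imI (cst K) (fun=> True) = imI tof (fun=> True).
Proof.
rewrite -imgX_prod; congr (imI tof); apply: pred_ext => // p _.
exact: IntT_coef.
Qed.

(** Euclidean descent: a nonzero element that does not divide all the others leaves a nonzero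
    remainder of smaller size. *)
Lemma poly_ideal_principal (I : {poly K} -> Prop) :
  submod (fun=> True) I -> (exists p, I p /\ p != 0) ->
  exists d, [/\ I d, d != 0 & forall p, I p -> exists q, p = d * q].
Proof.
move=> [I0 ID IM] [p [hp p0]]; have [n hn] := ubnP (size p).
elim: n p hp p0 hn => // n IH p hp p0 hn.
have [h|nh] := classic (forall r, I r -> exists q, r = p * q); first by exists p.
have [r k] := not_all_ex_not _ _ nh; have [hr n_r] := imply_to_and _ _ k.
have hm : I (r %% p).
  have -> : r %% p = r + (- (r %/ p)) * p by rewrite {2}(divp_eq r p); ring.
  by apply: ID => //; apply: IM.
have m0 : r %% p != 0.
  by apply/eqP => e; apply: n_r; exists (r %/ p); rewrite {1}(divp_eq r p) e addr0 mulrC.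
apply: (IH _ hm m0); apply: leq_trans (ltn_modpN0 _ p0) _; exact: hn.
Qed.

(** A nonzero element [y] of the inverse moves [A] into K[X]; if [d] generates the resulting ideal,
    then d/y generates [A]. *)
Lemma full_principal (A B : L -> Prop) :
  pinv (imgX (Int D) ** imI (cst K) (fun=> True)) A B ->
  exists x, x != 0 /\ A = smul x (imgX (Int D) ** imI (cst K) (fun=> True)).
Proof.
rewrite Int_R_full => hAB; have sP : subring (imI tof (fun=> True)) by apply: imI_subring.
have hF x : exists a b : L, [/\ imI tof (fun=> True) a, imI tof (fun=> True) b, b != 0 & x = a / b].
  have [a [b [b0 e]]] := fractionP x; exists (tof a), (tof b); split=> //.
  - by exists a.
  - by exists b.
  - by rewrite tofrac_eq0.
have [mA mB e] := hAB.
have /(invertibleP _ sP hF) [[_ [x [hx x0]] _] [B' [[_ [y [hy y0]] _] e']]] :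
  exists J, pinv (imI tof (fun=> True)) A J by exists B.
have hA z : A z -> imI tof (fun=> True) (y * z).
  by move=> hz; apply: (proj1 (e' _)); rewrite mulrC; apply: prodI_mul.
pose I p := A (y^-1 * tof p).
have mI : submod (fun=> True) I.
  have [A0 AD AM] := mA; split; rewrite /I.
  - by rewrite tofrac0 mulr0.
  - by move=> p q hp hq'; rewrite tofracD mulrDr; apply: AD.
  - move=> a p _ hp; rewrite tofracM mulrCA; apply: AM => //; by exists a.
have lift z : A z -> exists p, I p /\ z = y^-1 * tof p.
  move=> hz; have [p [_ ep]] := hA z hz; exists p; rewrite /I -ep mulKf //.
have [|d [hd d0 hdiv]] := poly_ideal_principal mI.
  have [p [hp ep]] := lift x hx; exists p; split=> //.
  by apply: contraNneq x0 => p0; rewrite ep p0 tofrac0 mulr0.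
exists (y^-1 * tof d); split.
  by apply: mulf_neq0; [apply: invr_neq0 | rewrite tofrac_eq0].
apply: pred_ext => z.
  move=> /lift [p [/hdiv [q ->] ->]]; exists (tof q).
  by split; [exists q | rewrite tofracM mulrA].
move=> [_ [[q [_ ->]] ->]]; rewrite mulrC; case: mA => _ _; apply=> //; by exists q.
Qed.

Lemma full_units (x y : L) : x != 0 -> y != 0 ->
  smul x (imgX (Int D) ** imI (cst K) (fun=> True)) =
  smul y (imgX (Int D) ** imI (cst K) (fun=> True)) ->
  exists k, k != 0 /\ x = y * cst K k.
Proof.
rewrite Int_R_full => x0 y0 e.
have one : imI tof (fun=> True) 1 by exists 1; rewrite tofrac1.
have [_ [[p [_ ->]] ex]] : smul y (imI tof (fun=> True)) x.
  by rewrite -e; exists 1; rewrite mulr1.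
have [_ [[q [_ ->]] ey]] : smul x (imI tof (fun=> True)) y.
  by rewrite e; exists 1; rewrite mulr1.
have pq : p * q = 1.
  apply: tof_inj; rewrite tofracM tofrac1; apply: (mulfI y0).
  by rewrite mulrA -ex -ey mulr1.
have : size p == 1%N.
  have p0 : p != 0 by apply: contra_eq_neq pq => ->; rewrite mul0r eq_sym oner_neq0.
  have q0 : q != 0 by apply: contra_eq_neq pq => ->; rewrite mulr0 eq_sym oner_neq0.
  have := size_mul p0 q0; rewrite pq size_poly1.
  move: p0 q0; rewrite -!size_poly_gt0; case: (size p) => [|[|m]] //; case: (size q) => // k _ _.
  by rewrite addSn addnS.
move=> /size_poly1P [k k0 ep]; exists k; split=> //.
by rewrite ex ep.
Qed.

End RationalFunctionFacts.

Lemma compact_almost (K : fieldType) (D : K -> Prop) Th Tinf :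
  quotient_field_of D -> pre_Jaffard D Th ->
  (forall T, Th T -> T <> Tinf -> exists T', comp_pair D T T') ->
  forall x, Tinf x -> almost Th (fun T => T x).
Proof.
move=> hq [hO [_ _ _ hind hc]] hpair x hx.
have sub T : Th T -> subring T by move=> /hO [].
have over T : Th T -> D [<=] T by move=> /hO [].
(* The open set of overrings containing [y] meets [Th] in at most one member without [x]. *)
pose P y := forall S S', Th S -> Th S' -> S y -> S' y -> ~ S x -> ~ S' x -> S = S'.
pose U y S := [/\ is_overring D S, S y & P y].
have [||l hl] := hc K U.
- move=> y; split=> [T []//|T [_ hy hP]]; exists [:: y]; split.
    by move=> z; rewrite inE => /eqP ->.
  by move=> T' hT' h; split=> //; apply: h; apply: mem_head.
- move=> T hT; have [e|nT] := classic (T = Tinf).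
    (* At T_oo the choice y = x works, since no member containing it omits [x]. *)
    exists x; split; [exact: hO | by rewrite e |].
    by move=> S S' _ _ h1 _ n1 _; case: n1.
  have [T' hP] := hpair T hT nT; have [sT sT' DT DT' [hI he]] := hP.
  case: (hq) => hD /(_ x) [a [b [ha hb b0 ex]]].
  have [e [hDe h1 h2]] := he b hb b0.
  (* A member other than [T] contains [T'], hence (1 - e)/b; if it also contains e/b, it contains
     1/b and x = a/b. So [T] is the only member containing e/b that may omit [x]. *)
  exists (e / b); split=> //.
  have only S : Th S -> S (e / b) -> ~ S x -> S = T.
    move=> hS hSy nS; apply: NNPP => n; case: nS.
    have T'S : T' [<=] S.
      apply: (pair_sub_other hq hP); [exact: sub | exact: over |].
      by apply: pred_ext => // z _; apply/(hind T S hT hS) => // k; apply: n.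
    have -> : x = (1 - e) / b * a + a * (e / b) by rewrite ex; field.
    apply: subrD; first exact: sub.
      by apply: subrM; [apply: sub | apply: T'S | apply: over].
    by apply: subrM => //; [apply: sub | apply: over].
  by move=> S S' hS hS' k1 k2 n1 n2; rewrite (only S hS k1 n1) (only S' hS' k2 n2).
suff [l' hl'] : exists l', forall T, Th T -> ~ T x ->
    (exists y, List.In y l /\ U y T) -> List.In T l'.
  by exists l' => T hT n; apply: hl' => //; apply: hl.
elim: l {hl} => [|y l [l' IH]]; first by exists nil => T _ _ [y []].
have [[S [hS nS [_ hSy hP]]]|none] := classic (exists S, [/\ Th S, ~ S x & U y S]).
  exists (S :: l') => T hT nT [z [[<-|hz] hzT]]; last by right; apply: IH => //; exists z.
  by left; case: hzT => _ hTy _; apply: hP.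
exists l' => T hT nT [z [[e|hz] hzT]]; last by apply: IH => //; exists z.
by case: none; exists T; rewrite e.
Qed.

(** * Translation between the groups of the statement and the relation [rel] *)

Section PicardRelation.
Variables (K : fieldType) (D : K -> Prop) (hq : quotient_field_of D).
Local Notation R T := (imgX (Int D) ** imI (cst K) T).
Let hD : subring D. Proof. by case: hq. Qed.

Lemma pic_memP T P I : subring T -> imgX P = R T ->
  sg_mem (s := PicRel T P) I <-> exists J, pinv (R T) I J.
Proof.
move=> sT e; rewrite /= e; apply: invertibleP.
  by apply: R_subring => //; apply: Int_R_subring.
move=> x; have [a [b [ha hb b0 ex]]] := Int_R_quotient hq x.
by exists a, b; split=> //; apply: R0_sub_R.
Qed.

Lemma pic_eqvP T P I J : quotient_field_of T -> imgX P = R T -> submod (R T) J ->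
  sg_eqv (s := PicRel T P) I J <-> rel (cst K) T I J.
Proof.
move=> hqT e mJ; have [sT hF] := hqT; rewrite /= e.
have sR : subring (R T) by apply: R_subring => //; apply: Int_R_subring.
have eJ I0 : J ** (constX I0 ** R T) = J ** imI (cst K) I0.
  by rewrite constX_im prodIA prodIAC (submod_prodI sR mJ).
split.
  move=> [x [x0 [I0 [hI0 h]]]]; have [J0 hJ0] := proj1 (invertibleP I0 sT hF) hI0.
  exists x, I0, J0; split=> //; rewrite -eJ.
  by apply: pred_ext => z; [apply: (proj1 (h z)) | apply: (proj2 (h z))].
move=> [x [I0 [J0 [x0 hI0 eI]]]]; exists x; split=> //; exists I0; split.
  by apply: (proj2 (invertibleP I0 sT hF)); exists J0.
by move=> z; rewrite eI eJ.
Qed.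

End PicardRelation.

Theorem theorem6p4 (K : fieldType) (D : K -> Prop)
    (Theta : (K -> Prop) -> Prop) (Tinf : K -> Prop)
    (hD : quotient_field_of D)
    (hTheta : weak_Jaffard_pointed D Theta Tinf) :
  short_exact
    (DSum (fun T : K -> Prop => Theta T /\ T <> Tinf) (fun T => PicInt T))
    (PicInt D)
    (PicIntRel D Tinf).
Proof.
case: hTheta => hpre hN.
have hC := pre_Jaffard_complete hD hpre.
have hinf : Theta Tinf by case: (proj2 (hN Tinf) erefl).
have hpair T : Theta T -> T <> Tinf -> exists T', comp_pair D T T'.
  move=> hT nT; apply: jaffard_pair => //; apply: NNPP => n.
  by apply: nT; apply: (proj1 (hN T)).
have hcpt := compact_almost hD hpre hpair.
have hind T S : Theta T -> Theta S -> T <> S -> T ** S = (fun=> True).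
  move=> hT hS n; apply: pred_ext => // z _; case: hpre => _ [_ _ _ h _].
  exact: (proj2 (h T S hT hS n z)).
have sD : subring D by case: hD.
have sub T : Theta T -> subring T by case: hC => h _ /h [].
have over T : Theta T -> D [<=] T by case: hC => h _ /h [].
have qT T : Theta T -> quotient_field_of T.
  by move=> hT; apply: overring_quotient hD _ _; [apply: sub | apply: over].
pose c := cst K; pose R0 := imgX (Int D); pose R T := R0 ** imI c T.
have sR0 : subring R0 := Int_R_subring hD.
have DR0 : imI c D [<=] R0 := @Int_R_const K D.
have R0c : forall k, R0 (c k) -> D k := Int_R_cap hD.
have sR T : Theta T -> subring (R T) by move=> hT; apply: R_subring => //; apply: sub.
have eD : imgX (Int D) = R D by rewrite /R RD.
(* For a member with a complement the classes over Int(T) are those over [R T]; at T_oo the third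
   group is defined with Int(D) T_oo directly. *)
have eT T : Theta T -> T <> Tinf -> imgX (Int T) = R T.
  move=> hT nT; have [T' hP] := hpair T hT nT.
  by rewrite (Int_pair hD hP) imgX_prod.
have eI : imgX (IntT D Tinf) = R Tinf := imgX_prod (Int D) Tinf.
have RRD : R D = R0 by rewrite -eD.
have pR T I J : Theta T -> pinv R0 I J -> pinv (R T) (I ** imI c T) (J ** imI c T).
  by move=> hT; apply: pinv_R; apply: sub.
have modT T A B : Theta T -> pinv (R T) A B -> A ** imI c T = A.
  by move=> hT [mA _ _]; apply: R_mod_imI mA => //; apply: sub.
have reflT T A B : Theta T -> pinv (R T) A B -> rel c T A A.
  by move=> hT hA; apply: rel_refl; [apply: sub | exact: (modT _ _ _ hT hA)].
have eqvD I J J' : pinv R0 J J' -> sg_eqv (s := PicInt D) I J <-> rel c D I J.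
  by rewrite -{1}RRD => -[mJ _ _]; exact: (pic_eqvP hD I hD eD mJ).
have eqvT T I J J' : Theta T -> T <> Tinf -> pinv (R T) J J' ->
    sg_eqv (s := PicInt T) I J <-> rel c T I J.
  by move=> hT nT [mJ _ _]; exact: (pic_eqvP hD I (qT T hT) (eT T hT nT) mJ).
have eqvI I J J' : pinv (R Tinf) J J' ->
    sg_eqv (s := PicIntRel D Tinf) I J <-> rel c Tinf I J.
  by move=> [mJ _ _]; exact: (pic_eqvP hD I (qT _ hinf) eI mJ).
have memD I : sg_mem (s := PicInt D) I <-> exists J, pinv R0 I J.
  rewrite -{1}RRD; exact: (pic_memP hD I sD eD).
have memT T I : Theta T -> T <> Tinf -> sg_mem (s := PicInt T) I <-> exists J, pinv (R T) I J.
  by move=> hT nT; exact: (pic_memP hD I (sub T hT) (eT T hT nT)).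
have memI I : sg_mem (s := PicIntRel D Tinf) I <-> exists J, pinv (R Tinf) I J.
  exact: (pic_memP hD I (sub _ hinf) eI).
have selfT T : Theta T -> pinv (R T) (R T) (R T) by move=> hT; apply: pinv_self; apply: sR.
have self0 : pinv R0 R0 R0 by apply: pinv_self.
have oneT T I : Theta T -> T <> Tinf ->
    sg_eqv I (sg_one (PicInt T)) <-> rel c T I (R T).
  move=> hT nT; have -> : sg_one (PicInt T) = R T := eT T hT nT.
  exact: eqvT hT nT (selfT T hT).
have oneI I : sg_eqv I (sg_one (PicIntRel D Tinf)) <-> rel c Tinf I (R Tinf).
  have -> : sg_one (PicIntRel D Tinf) = R Tinf := eI.
  exact: eqvI (selfT Tinf hinf).
pose A := DSum (fun T : K -> Prop => Theta T /\ T <> Tinf) (fun T => PicInt T).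
pose spec (s : sg_car A) (I : KX K -> Prop) := [/\ exists J, pinv R0 I J,
  forall T, Theta T -> T <> Tinf -> rel c T (I ** imI c T) (s T) &
  rel c Tinf (I ** imI c Tinf) (R Tinf)].
have spec_ex s : sg_mem s -> exists I, spec s I.
  move=> [hs [l hl]].
  have [||I [J [h1 h2 h3]]] := lift_finite (l := l) (s := s) hD hC hind hpair hinf sR0 DR0
      (full_principal hD).
  - by move=> T hT nT; apply: (proj1 (memT T _ hT nT)); apply: hs.
  - move=> T hT nT n; apply: hl => // h; apply: n.
    exact: (proj1 (oneT T _ hT nT) h).
  by exists I; split=> //; exists J.
(* The specification fixes the class and not the module, so [epsilon] picks a representative;
   compatibility with equivalence and products comes from [uniq]. *)
pose f (s : sg_car A) : sg_car (PicInt D) := epsilon (inhabits R0) (spec s).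
have f_spec s : (exists I, spec s I) -> spec s (f s) by apply: epsilon_spec.
have invT (s : sg_car A) T : sg_mem s -> Theta T -> T <> Tinf -> exists B, pinv (R T) (s T) B.
  by move=> [hs _] hT nT; apply: (proj1 (memT T _ hT nT)); apply: hs.
have uniq I J I' J' : pinv R0 I J -> pinv R0 I' J' ->
    (forall T, Theta T -> rel c T (I ** imI c T) (I' ** imI c T)) -> rel c D I I'.
  exact: (rel_of_local hD hC hinf sR0 DR0 R0c (full_units hD)).
have spec_uniq s s' I I' : sg_mem s -> sg_mem s' -> spec s I -> spec s' I' ->
    (forall T, Theta T -> T <> Tinf -> rel c T (s T) (s' T)) -> rel c D I I'.
  move=> hs hs' [[J hJ] hI iI] [[J' hJ'] hI' iI'] h; apply: (uniq _ _ _ _ hJ hJ') => T hT.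
  have sT := sub T hT; have [->|nT] := classic (T = Tinf).
    apply: rel_trans iI _; first exact: sub.
    by apply: rel_sym iI'; exact: (modT _ _ _ hinf (selfT _ hinf)).
  apply: rel_trans (hI T hT nT) _ => //; apply: rel_trans (h T hT nT) _ => //.
  have [B hB] := invT s' T hs' hT nT.
  by apply: rel_sym (hI' T hT nT); exact: (modT _ _ _ hT hB).
exists f, (fun I => I ** imI c Tinf); split.
- split.
  + move=> s /spec_ex /f_spec [hJ _ _]; exact: (proj2 (memD _)).
  + move=> s t hs ht hst.
    have [[J hJ] _ _] := f_spec _ (spec_ex _ ht).
    apply: (proj2 (eqvD _ _ _ hJ)).
    apply: spec_uniq (f_spec _ (spec_ex _ hs)) (f_spec _ (spec_ex _ ht)) _ => // T hT nT.
    have [B hB] := invT t T ht hT nT.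
    by apply: (proj1 (eqvT T _ _ _ hT nT hB)); apply: hst.
  + move=> s t hs ht.
    have hf := f_spec _ (spec_ex _ hs); have hg := f_spec _ (spec_ex _ ht).
    (* The product of the chosen modules meets the specification of the product family, hence has
       the class chosen for it. *)
    have hm : spec (sg_op s t) (f s ** f t).
      case: hf hg => [[J1 k1] k2 k3] [[J2 l1] l2 l3]; split.
      * by exists (J1 ** J2); apply: pinv_mul.
      * move=> T hT nT; have sT := sub T hT; rewrite prodI_imI //.
        by apply: rel_mul; [| apply: k2 | apply: l2].
      * have sI := sub Tinf hinf; rewrite prodI_imI // -(prodI_self (sR _ hinf)).
        by apply: rel_mul.
    have [[J hJ] _ _] := hm; apply: (proj2 (eqvD _ _ _ hJ)).
    have [[J' hJ'] k2 k3] := f_spec _ (ex_intro _ _ hm).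
    have [_ l2 l3] := hm.
    apply: (uniq _ _ _ _ hJ' hJ) => T hT; have sT := sub T hT.
    have [->|nT] := classic (T = Tinf).
      apply: rel_trans k3 _; first exact: sub.
      by apply: rel_sym l3; exact: (modT _ _ _ hinf (selfT _ hinf)).
    apply: rel_trans (k2 T hT nT) _ => //.
    have [B hB] := invT s T hs hT nT; have [B' hB'] := invT t T ht hT nT.
    by apply: rel_sym (l2 T hT nT); exact: (modT _ _ _ hT (pinv_mul (sR T hT) hB hB')).
- split.
  + move=> I hI; have [J hJ] := proj1 (memD I) hI.
    by apply: (proj2 (memI _)); exists (J ** imI c Tinf); apply: pR.
  + move=> I I' hI hI' h; have [J' hJ'] := proj1 (memD I') hI'.
    apply: (proj2 (eqvI _ _ _ (pR _ _ _ hinf hJ'))).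
    exact: (rel_ext hD (sub _ hinf) (over _ hinf) (proj1 (eqvD _ _ _ hJ') h)).
  + move=> I I' hI hI'; have [J hJ] := proj1 (memD I) hI; have [J' hJ'] := proj1 (memD I') hI'.
    have h := pR _ _ _ hinf (pinv_mul sR0 hJ hJ').
    rewrite /= -prodI_imI; last exact: sub.
    by apply: (proj2 (eqvI _ _ _ h)); exact: (reflT _ _ _ hinf h).
(* Injectivity: localizing the trivial class of [f s] at [T] gives back the class of [s T]. *)
- move=> s hs h T [hT nT]; have [[J hJ] k2 _] := f_spec _ (spec_ex _ hs).
  have h0 : rel c D (f s) R0 := proj1 (eqvD _ _ _ self0) h.
  have sT := sub T hT; apply: (proj2 (oneT T _ hT nT)).
  have [B hB] := invT s T hs hT nT.
  apply: (rel_trans (J := f s ** imI c T)) => //.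
    by apply: rel_sym (k2 T hT nT); exact: (modT _ _ _ hT hB).
  exact: (rel_ext hD sT (over T hT) h0).
- move=> I hI; have [J hJ] := proj1 (memD I) hI; split.
    move=> /(proj1 (oneI _)) hg.
    (* Finite support is what places the family of localizations of [I] in the direct sum. *)
    have [l hl] := rel_finite_support hC hinf hcpt sR0 hJ hg.
    pose s : sg_car A := fun T => I ** imI c T.
    have hs : sg_mem s.
      split=> [T [hT nT]|].
        by apply: (proj2 (memT T _ hT nT)); exists (J ** imI c T); apply: pR.
      exists l => T [hT nT] n; apply: hl => // h; apply: n.
      exact: (proj2 (oneT T _ hT nT)).
    exists s; split=> //; apply: (proj2 (eqvD _ _ _ hJ)).
    apply: spec_uniq (f_spec _ (spec_ex _ hs)) _ _; [exact: hs | exact: hs | |].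
      split; [by exists J | | by []].
      by move=> T hT nT; exact: (reflT _ _ _ hT (pR _ _ _ hT hJ)).
    by move=> T hT nT; exact: (reflT _ _ _ hT (pR _ _ _ hT hJ)).
  move=> [s [hs h]]; have [_ _ k3] := f_spec _ (spec_ex _ hs).
  have h0 : rel c D (f s) I := proj1 (eqvD _ _ _ hJ) h.
  apply: (proj2 (oneI _)).
  apply: rel_trans k3; first exact: sub.
  apply: rel_sym; first exact: (modT _ _ _ hinf (pR _ _ _ hinf hJ)).
  exact: (rel_ext hD (sub _ hinf) (over _ hinf) h0).
- move=> B hB; have [B' hB'] := proj1 (memI B) hB.
  have [I [J [hI h]]] := lift_infinity hD hC hind hpair hinf hcpt sR0 DR0 (full_principal hD) hB'.
  exists I; split; first by apply: (proj2 (memD I)); exists J.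
  exact: (proj2 (eqvI _ _ _ hB')).
Qed.
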